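(* 1. Let $m\in\mathcal{A}^c_3$, let $\mathbb{F}_{Q_m}$ be a splitting field of $Q_m$ and let $\widetilde{\mathrm{Aut}}(m)=\{g\in GL(V\otimes_{\mathbb F}\mathbb{F}_{Q_m}):g\cdot m=m\}$. Then $$\widetilde{\mathrm{Aut}}(m)\cong\begin{cases}\{1\}&\text{if }\mathrm{Inv}_m\ne0,\\ \mathbb{Z}_2&\text{if }\mathrm{Inv}_m=0\text{ and }(p_2(m),p_3(m))\ne(0,0),\\ S_3&\text{if }p_2(m)=p_3(m)=0.\end{cases}$$ 2. Let $m\in\mathcal{A}^c_3$ and let $\mathrm{Aut}(m)=\{g\in GL(V):g\cdot m=m\}$. Then $$\mathrm{Aut}(m)\cong\begin{cases}\{1\}&\text{if }\mathrm{Inv}_m\ne0,\\ \mathbb{Z}_2&\text{if }\mathrm{Inv}_m=0\text{ and }(p_2(m),p_3(m))\ne(0,0),\\ S_3&\text{if }p_2(m)=p_3(m)=0\text{ and }[\mathbb{F}_{Q_m}:\mathbb{F}]=1,\\ \mathbb{Z}_2&\text{if }p_2(m)=p_3(m)=0\text{ and }[\mathbb{F}_{Q_m}:\mathbb{F}]=2,\\ \mathbb{Z}_3&\text{if }p_2(m)=p_3(m)=0\text{ and }[\mathbb{F}_{Q_m}:\mathbb{F}]=3,\\ \{1\}&\text{if }p_2(m)=p_3(m)=0\text{ and }[\mathbb{F}_{Q_m}:\mathbb{F}]=6.\end{cases}$$ Here $S_3$ is the group of permutations of three objects.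
   Context: $\mathbb{F}$ is a field of characteristic different from $2$ and $3$, and $V$ is a two-dimensional $\mathbb{F}$-vector space. $L=\Lambda^2(V^* )$, $L^r$ its $r$-th tensor power. $\mathcal{A}^c$ is the set of symmetric bilinear maps $m:V\times V\to V$, with $GL(V)$-action $(g\cdot m)(v,w)=g\big(m(g^{-1}v,g^{-1}w)\big)$; the same formula is used over an extension field, $m$ being extended bilinearly. Let $(e_1,e_2)$ be a basis of $V$ with dual basis $(\epsilon_1,\epsilon_2)$, put $\omega=\epsilon_1\wedge\epsilon_2$, and write $m(e_1,e_1)=ae_1+be_2$, $m(e_2,e_2)=ce_1+de_2$, $m(e_1,e_2)=ee_1+fe_2$. The fundamental cubic is $Q_m(v)=m(v,v)\wedge v$; thus $Q_m(xe_1+ye_2)=q(x,y)\,e_1\wedge e_2$ with $q(x,y)=-bx^3+(a-2f)x^2y+(2e-d)xy^2+cy^3$. Writing $q=Ax^3+Bx^2y+Cxy^2+Dy^3$, $\mathrm{Disc}(Q_m)=(18ABCD+B^2C^2-4AC^3-4B^3D-27A^2D^2)\,\omega^2\in L^2$. Put $\mu(x,y)=q_{xx}q_{yy}-q_{xy}^2$, $G(x,y)=q_x\mu_y-q_y\mu_x$, $\tau=(d+e,-(a+f))$. Define $\tilde p_3(m)=-8q(\tau)\omega^2\in L^2$, $\tilde p_2(m)=\mu(\tau)\omega^2\in L^2$, $\mathrm{Inv}_m=\frac1{54}G(\tau)\omega^3\in L^3$ (independent of the basis). $\mathcal{A}^c_3=\{m:\mathrm{Disc}(Q_m)\ne0\}$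 and, for $m\in\mathcal{A}^c_3$, $p_i(m)=\tilde p_i(m)/\mathrm{Disc}(Q_m)\in\mathbb{F}$. For $m\in\mathcal{A}^c_3$ one has $\mathrm{Inv}_m=0$ iff $27p_3(m)^2+4p_2(m)^3=0$. A splitting field of $Q_m$ is a smallest extension of $\mathbb{F}$ over which $q$ factors into linear forms; its degree over $\mathbb{F}$ is $1,2,3$ or $6$. *)

(* Defs.v *)
From HB Require Import structures.
From mathcomp Require Import all_boot all_algebra all_fingroup all_field.
From mathcomp Require Import sesquilinear.
From mathcomp Require Import mpoly.

Set Implicit Arguments.
Unset Strict Implicit.
Unset Printing Implicit Defensive.

Import GRing.Theory.
Local Open Scope ring_scope.

Section Automorphisms.
Variables (F : fieldType) (V : vectType F).
Implicit Types (m : {bilinear V -> V -> V}) (g : 'End(V)).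

Definition in_GL g : bool := lker g == 0%VS.

(* [g^-1%VF] is a two-sided inverse of [g] when [in_GL g]. *)
Definition gl_act g m (v w : V) : V := g (m (g^-1%VF v) (g^-1%VF w)).

Definition is_aut m g : Prop := in_GL g /\ forall v w, gl_act g m v w = m v w.

(* The set [A], with composition of linear maps, is a group isomorphic
   to [gT]. *)
Definition isomorphic_to (A : 'End(V) -> Prop) (gT : finGroupType) : Prop :=
  exists f : gT -> 'End(V),
    [/\ injective f,
        forall g, A g <-> exists x, f x = g
      & forall x y, f (x * y)%g = (f x \o f y)%VF].

End Automorphisms.

Section ScalarExtension.
Variables (F : fieldType) (K : fieldExtType F) (V : vectType F).
Variable VK : vectType K.

(* A map from an F-space to a K-space that is F-linear, i.e. linear along the
   embedding [in_alg K] of F in K; [iota v] stands for [v ⊗ 1]. *)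
Variable iota : {linear V -> VK | GRing.in_alg K \; *:%R}.

(* Universal property of V ⊗_F K. *)
Definition scalar_extension : Prop :=
  forall (W : lmodType K) (f : {linear V -> W | GRing.in_alg K \; *:%R}),
    exists2 g : {linear VK -> W},
      forall v, g (iota v) = f v
      & forall g' : {linear VK -> W},
          (forall v, g' (iota v) = f v) -> g' =1 g.

(* This determines [mK], since the vectors [iota v] span [VK]. *)
Definition extends_bilinear (m : {bilinear V -> V -> V})
    (mK : {bilinear VK -> VK -> VK}) : Prop :=
  forall v w, mK (iota v) (iota w) = iota (m v w).

End ScalarExtension.

Section Splitting.
Variables (F : fieldType) (K : fieldExtType F) (q : {mpoly F[2]}).

Definition splits_over (E : {subfield K}) : Prop :=
  exists l1 l2 l3 : {mpoly K[2]},
    (forall l, l \in [:: l1; l2; l3] ->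
       (l \is a mpolyOver 2 E) && (l \is 1.-homog)) /\
    map_mpoly (GRing.in_alg K) q = l1 * l2 * l3.

Definition is_splitting_field : Prop :=
  splits_over {:K}%AS /\
  forall E : {subfield K}, splits_over E -> (E : {vspace K}) = {:K}%VS.

End Splitting.

(* Elements of L^r are given by their coefficient on omega^r, where omega is
   the wedge of the basis dual to [e]. *)
Section Invariants.
Variables (F : fieldType) (V : vectType F) (m : {bilinear V -> V -> V}).
Variable e : 2.-tuple V.

Local Notation i0 := (ord0 : 'I_2).
Local Notation i1 := (ord_max : 'I_2).

Definition sc_a : F := coord e i0 (m e`_0 e`_0).
Definition sc_b : F := coord e i1 (m e`_0 e`_0).
Definition sc_c : F := coord e i0 (m e`_1 e`_1).
Definition sc_d : F := coord e i1 (m e`_1 e`_1).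
Definition sc_e : F := coord e i0 (m e`_0 e`_1).
Definition sc_f : F := coord e i1 (m e`_0 e`_1).

Definition cub_A : F := - sc_b.
Definition cub_B : F := sc_a - 2%:R * sc_f.
Definition cub_C : F := 2%:R * sc_e - sc_d.
Definition cub_D : F := sc_c.

(* The e1 ∧ e2 coefficient of m(v, v) ∧ v at v = x e1 + y e2. *)
Definition fund_cubic : {mpoly F[2]} :=
  cub_A *: 'X_i0 ^+ 3 + cub_B *: ('X_i0 ^+ 2 * 'X_i1)
  + cub_C *: ('X_i0 * 'X_i1 ^+ 2) + cub_D *: 'X_i1 ^+ 3.

Definition disc : F :=
  18%:R * cub_A * cub_B * cub_C * cub_D + cub_B ^+ 2 * cub_C ^+ 2
  - 4%:R * cub_A * cub_C ^+ 3 - 4%:R * cub_B ^+ 3 * cub_D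
  - 27%:R * cub_A ^+ 2 * cub_D ^+ 2.

Definition cub_mu : {mpoly F[2]} :=
  fund_cubic^`M(i0)^`M(i0) * fund_cubic^`M(i1)^`M(i1)
  - fund_cubic^`M(i0)^`M(i1) ^+ 2.

Definition cub_G : {mpoly F[2]} :=
  fund_cubic^`M(i0) * cub_mu^`M(i1) - fund_cubic^`M(i1) * cub_mu^`M(i0).

Definition tau : 'I_2 -> F :=
  tnth [tuple sc_d + sc_e; - (sc_a + sc_f)].

Definition p3_tilde : F := - 8%:R * fund_cubic.@[tau].
Definition p2_tilde : F := cub_mu.@[tau].
Definition Inv : F := 54%:R^-1 * cub_G.@[tau].

Definition p2 : F := p2_tilde / disc.
Definition p3 : F := p3_tilde / disc.

End Invariants.

(* Main.v *)
From Stdlib Require Classical_Prop.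
From HB Require Import structures.
Require Import Defs.
From mathcomp Require Import all_boot all_algebra all_fingroup all_field.
From mathcomp Require Import sesquilinear ring.
From mathcomp Require Import mpoly.

Set Implicit Arguments.
Unset Strict Implicit.
Unset Printing Implicit Defensive.

Import GRing.Theory.
Local Open Scope ring_scope.

(** Write [q] for the fundamental cubic and [lam] for the linear form sending
    [v] to the trace of [m(v, -)]. The identity
    [3 m(v,v) ∧ w = dq_v(w) + 2 lam(v) (v ∧ w)] ([wedge_square]) recovers the
    multiplication from the pair [(q, lam)] when 2 and 3 are invertible, and
    [q] and [lam] are natural in [m]. So [g] is an automorphism exactly when
    [q(gv) = det(g) q(v)] and [lam(gv) = lam(v)] ([is_autE]), and the problem
    is about binary cubics. The vector [tau] is dual to [lam] under the wedge.

    The endomorphisms [g] with [q(gv) = det(g) q(v)] are classified without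
    leaving the base field, by means of the traceless endomorphism [J] attached
    to the Hessian form of [q], which satisfies [J^2 = -3 disc]. As the Hessian
    is a covariant, [g J = det(g) J g] and [det(g)^2 = 1].
    - If [det(g) = 1] then [g] commutes with [J], so [g = al + be J], and
      evaluating [q] on this pencil leaves only [g = 1] and
      [g = (-1 + J/dl)/2] with [dl^2 = disc] ([cubic_aut_det1]). The latter have
      order three.
    - If [det(g) = -1] then [g] is an involution, its fixed vector is a zero of
      [q], and its other eigenvector is a zero of the cubic covariant
      [G]. Conversely each zero of [G] is negated by such an involution
      ([reflection]), and [J] maps zeros of [q] to zeros of [G].
    In short, rotations of order three come from square roots of the
    discriminant and involutions come from roots of [q]; if both are present,
    the group permutes the three root lines and is [S_3] ([aut_mx_root_sqrt]).

    Since [q] and its Hessian have no common zero, [p_2 = p_3 = 0] means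
    [tau = 0], hence [lam = 0]. If [lam <> 0], no rotation [r] of order three
    fixes [lam], because [1 + r + r^2 = 0]; and an involution fixing [lam]
    negates [tau], so it exists exactly when [G(tau) = 0], that is when
    [Inv = 0].

    If [lam = 0] it remains to read off from the degree of a splitting field
    whether [q] has a root and [disc] a square root in the base field. A
    syzygy ([cubic_factor]) factors [q] explicitly once one root and one square
    root of [disc] are known, so [q] splits over a subfield [E] exactly when [E]
    contains both ([splits_over_root], [root_splits_over]). The degrees
    1, 2, 3 and 6 then correspond to the four combinations ([root_dim],
    [noroot_dim]). For the first part of the statement, the same analysis is
    applied to the extended multiplication over the splitting field. *)

(** * Matrices and vectors of size two *)

Section TwoByTwo.
Variable F : fieldType.
Implicit Types (M N : 'M[F]_2) (v w : 'cV[F]_2).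

(** The four sample points (1,0), (0,1), (1,1), (1,-1) of the projective line
    determine a binary cubic as soon as 2 is invertible. *)
Lemma binary_cubic_eq (a b c d a' b' c' d' : F) : 2 != 0 :> F ->
  (forall x y, a * x ^+ 3 + b * x ^+ 2 * y + c * x * y ^+ 2 + d * y ^+ 3
     = a' * x ^+ 3 + b' * x ^+ 2 * y + c' * x * y ^+ 2 + d' * y ^+ 3) ->
  [/\ a = a', b = b', c = c' & d = d'].
Proof.
pose q (k l m n x y : F) :=
  k * x ^+ 3 + l * x ^+ 2 * y + m * x * y ^+ 2 + n * y ^+ 3.
move=> nz2 e; have {}e x y : q a b c d x y = q a' b' c' d' x y by exact: e.
have ea : a = a' by apply: (etrans _ (etrans (e 1 0) _)); rewrite /q; ring.
have ed : d = d' by apply: (etrans _ (etrans (e 0 1) _)); rewrite /q; ring.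
split=> //; apply: (mulfI nz2).
  have E k l m n : 2 * l = q k l m n 1 1 - q k l m n 1 (- 1) - 2 * n.
    by rewrite /q; ring.
  by rewrite (E a _ c d) !e ed -E.
have E k l m n : 2 * m = q k l m n 1 1 + q k l m n 1 (- 1) - 2 * k.
  by rewrite /q; ring.
by rewrite (E a b _ d) !e ea -E.
Qed.

Definition mx22 (a b c d : F) : 'M[F]_2 :=
  \matrix_(i, j) if i == 0 then if j == 0 then a else b
                 else if j == 0 then c else d.

Lemma mx22E a b c d :
  (mx22 a b c d 0 0 = a) * (mx22 a b c d 0 1 = b) *
  (mx22 a b c d 1 0 = c) * (mx22 a b c d 1 1 = d).
Proof. by rewrite !mxE. Qed.

Lemma sum2E (U : nmodType) (f : 'I_2 -> U) : \sum_i f i = f 0 + f 1.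
Proof.
by rewrite big_ord_recl big_ord1; congr (_ + f _); apply: val_inj.
Qed.

Lemma mulmx2E m n (P : 'M[F]_(m, 2)) (Q : 'M[F]_(2, n)) i j :
  (P *m Q) i j = P i 0 * Q 0 j + P i 1 * Q 1 j.
Proof. by rewrite mxE sum2E. Qed.

Lemma ord2P (P : 'I_2 -> Prop) : P 0 -> P 1 -> forall i, P i.
Proof.
move=> P0 P1 [[|[|//]] lt_i].
  by have -> : Ordinal lt_i = 0 by apply: val_inj.
by have -> : Ordinal lt_i = 1 by apply: val_inj.
Qed.

Lemma mx2P M N : M 0 0 = N 0 0 -> M 0 1 = N 0 1 -> M 1 0 = N 1 0 ->
  M 1 1 = N 1 1 -> M = N.
Proof. by move=> *; apply/matrixP; do 2!elim/ord2P. Qed.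

Lemma cv2P v w : v 0 0 = w 0 0 -> v 1 0 = w 1 0 -> v = w.
Proof. by move=> *; apply/colP; elim/ord2P. Qed.

Lemma det2E M : \det M = M 0 0 * M 1 1 - M 0 1 * M 1 0.
Proof.
rewrite (expand_det_row _ 0) sum2E /cofactor !det_mx11 !mxE.
have -> : lift 0 0 = 1 :> 'I_2 by apply: val_inj.
have -> : lift 1 0 = 0 :> 'I_2 by apply: val_inj.
by rewrite /= expr0 expr1 mul1r mulN1r mulrN.
Qed.

Definition wedge v w := v 0 0 * w 1 0 - v 1 0 * w 0 0.

Lemma wedge_mulmx M v w : wedge (M *m v) (M *m w) = \det M * wedge v w.
Proof. by rewrite /wedge !mulmx2E det2E; ring. Qed.

Lemma wedge_eqP v w : (forall u, wedge v u = wedge w u) -> v = w.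
Proof.
move=> e; apply: cv2P.
  by have := e (\col_i (i == 1)%:R); rewrite /wedge !mxE !mulr1 !mulr0 !subr0.
have := e (\col_i (i == 0)%:R); rewrite /wedge !mxE !mulr1 !mulr0 !sub0r.
exact: oppr_inj.
Qed.

Lemma wedge_neq0 v : v != 0 -> exists w, wedge v w != 0.
Proof.
move=> nz_v; have [v0|nz_v0] := eqVneq (v 0 0) 0; last first.
  exists (\col_i if i == 0 then 0 else 1).
  by rewrite /wedge !mxE /= mulr1 mulr0 subr0.
exists (\col_i if i == 0 then 1 else 0).
rewrite /wedge !mxE /= v0 mul0r sub0r mulr1 oppr_eq0.
by apply: contra_neq nz_v => v1; apply: cv2P; rewrite ?v0 ?v1 mxE.
Qed.

End TwoByTwo.

(** * Matrix groups isomorphic to abstract groups *)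

Section MatrixGroups.
Variable F : fieldType.

Lemma expr_ord_inj (g : 'M[F]_2) n : g ^+ n.+1 = 1 ->
  (forall i, (0 < i <= n)%N -> g ^+ i != 1) ->
  injective (fun i : 'I_n.+1 => g ^+ i).
Proof.
move=> gn g_ord; have Ug : g \is a GRing.unit.
  by apply/unitrP; exists (g ^+ n); rewrite -exprS -exprSr gn.
suff le_inj (i j : 'I_n.+1) : (i <= j)%N -> g ^+ i = g ^+ j -> i = j.
  move=> i j /= e; case/orP: (leq_total i j) => [|] le_ij; first exact: le_inj.
  exact/esym/le_inj.
move=> le_ij e; have gij : g ^+ (j - i) = 1.
  by apply: (mulrI (unitrX i Ug)); rewrite mulr1 -exprD subnKC // e.
apply: val_inj; apply/eqP; rewrite eqn_leq le_ij -subn_eq0 /=; apply: contraT.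
rewrite -lt0n => lt_ij; have := g_ord (j - i)%N.
by rewrite lt_ij gij eqxx (leq_trans (leq_subr i j)) -1?ltnS // => /(_ isT).
Qed.

Definition mx_isomorphic_to (S : 'M[F]_2 -> Prop) (gT : finGroupType) :=
  exists f : gT -> 'M[F]_2,
    [/\ injective f, forall g, S g <-> exists x, f x = g
      & forall x y, f (x * y)%g = f x *m f y].

Lemma cyclic_mx_iso (S : 'M[F]_2 -> Prop) g n : g ^+ n.+1 = 1 ->
  (forall i, (0 < i <= n)%N -> g ^+ i != 1) ->
  (forall h, S h <-> exists i : 'I_n.+1, g ^+ i = h) ->
  mx_isomorphic_to S 'I_n.+1.
Proof.
move=> gn g_ord S_g; exists (fun i : 'I_n.+1 => g ^+ i).
split=> //; first exact: expr_ord_inj.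
by move=> i j /=; rewrite expr_mod // exprD.
Qed.

End MatrixGroups.

(** * Covariants of a binary cubic *)

Section BinaryCubic.
Variables (F : fieldType) (A B C D : F).
Implicit Types (g h : 'M[F]_2) (v w : 'cV[F]_2).

Definition cubic v :=
  A * v 0 0 ^+ 3 + B * v 0 0 ^+ 2 * v 1 0 + C * v 0 0 * v 1 0 ^+ 2
  + D * v 1 0 ^+ 3.

(** The differential of the cubic at [v], applied to [w]. *)
Definition dcubic v w :=
  (3 * A * v 0 0 ^+ 2 + 2 * B * v 0 0 * v 1 0 + C * v 1 0 ^+ 2) * w 0 0
  + (B * v 0 0 ^+ 2 + 2 * C * v 0 0 * v 1 0 + 3 * D * v 1 0 ^+ 2) * w 1 0.

Definition cubic_disc :=
  18 * A * B * C * D + B ^+ 2 * C ^+ 2 - 4 * A * C ^+ 3 - 4 * B ^+ 3 * D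
  - 27 * A ^+ 2 * D ^+ 2.

(** Up to the factor 4, the coefficients of [q_xx q_yy - q_xy^2]. *)
Definition hess0 := 3 * A * C - B ^+ 2.
Definition hess1 := 9 * A * D - B * C.
Definition hess2 := 3 * B * D - C ^+ 2.

Definition hessian v :=
  hess0 * v 0 0 ^+ 2 + hess1 * v 0 0 * v 1 0 + hess2 * v 1 0 ^+ 2.

(** The Gram matrix of the polar form of [hessian]. *)
Definition hess_mx := mx22 (2 * hess0) hess1 hess1 (2 * hess2).

Definition symp : 'M[F]_2 := mx22 0 1 (- 1) 0.

(** The symplectic gradient of the Hessian: [wedge (J v) w] is the polar form of
    [hessian] at [(v, w)]. *)
Definition hessJ := symp *m hess_mx.

(** The derivative of the cubic along the field [J], which is the Jacobian
    determinant of the cubic and its Hessian. *)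
Definition covG v := dcubic v (hessJ *m v).

Let disc := cubic_disc.

Definition unfoldE := (mulmx2E, mx22E, det2E).

Lemma hessJE : hessJ = mx22 hess1 (2 * hess2) (- (2 * hess0)) (- hess1).
Proof. by apply: mx2P; rewrite !unfoldE; ring. Qed.

Ltac expand := rewrite /covG /dcubic ?hessJE /cubic /disc /cubic_disc /hessian
  /wedge /hess_mx /symp ?unfoldE ?mxE ?sum2E ?mxE /= /hess0 /hess1 /hess2.

(** In an eigenbasis of [J] the cubic is a sum of two cubes [X^3 + Y^3], so
    [J] acts on it through cubes of eigenvalues; hence only [cubic] and [covG]
    occur. *)
Lemma cubic_pencil al be v :
  cubic (al *: v + be *: (hessJ *m v)) =
  (al ^+ 3 - 9 * al * be ^+ 2 * disc) * cubic v
  + (al ^+ 2 * be - be ^+ 3 * disc) * covG v.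
Proof. by expand; ring. Qed.

(** The classical relation between the covariants of a binary cubic. *)
Lemma syzygy v :
  covG v ^+ 2 + 27 * disc * cubic v ^+ 2 = - 4 * hessian v ^+ 3.
Proof. by expand; ring. Qed.

(** If [v] is a root, the right-hand side splits into linear forms in [w] as
    soon as [disc] is a square: this solves the cubic by one square root. In an
    eigenbasis of [J] both sides are multiples of a difference of two cubes. *)
Lemma cubic_factor v w :
  2 * (covG v * cubic w - cubic v * covG w) =
  wedge v w * (wedge (hessJ *m v) w ^+ 2 - disc * wedge v w ^+ 2).
Proof. by expand; ring. Qed.

Lemma wedge_hessJ v : wedge (hessJ *m v) v = 2 * hessian v.
Proof. by expand; ring. Qed.

Lemma hessJ_sq : hessJ *m hessJ = (- 3 * disc)%:M.
Proof. by apply: mx2P; expand; ring. Qed.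

Lemma det_hess_mx : \det hess_mx = 3 * disc.
Proof. by expand; ring. Qed.

Lemma pencilE al be : al%:M + be *: hessJ =
  mx22 (al + be * hess1) (2 * be * hess2) (- 2 * be * hess0) (al - be * hess1).
Proof.
rewrite hessJE.
apply: mx2P; rewrite mxE [in X in _ + X]mxE !unfoldE mxE ?mulr1n ?mulr0n;
  by ring.
Qed.

Lemma pencilM a b c d :
  (a%:M + b *: hessJ) *m (c%:M + d *: hessJ) =
  (a * c - 3 * disc * b * d)%:M + (a * d + b * c) *: hessJ.
Proof. by rewrite !pencilE; apply: mx2P; expand; ring. Qed.

Lemma cubicZ c v : cubic (c *: v) = c ^+ 3 * cubic v.
Proof. by expand; ring. Qed.

Lemma cubic_hessJ v : cubic (hessJ *m v) = - disc * covG v.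
Proof.
by have := cubic_pencil 0 1 v; rewrite scale0r add0r scale1r => ->; ring.
Qed.

Lemma covG_hessJ v : covG (hessJ *m v) = 27 * disc ^+ 2 * cubic v.
Proof. by expand; ring. Qed.

Hypotheses (nz2 : 2 != 0 :> F) (nz3 : 3 != 0 :> F) (nz_disc : disc != 0).

Lemma cubic_ex : exists v, cubic v != 0.
Proof.
pose v x y : 'cV[F]_2 := \col_i if i == 0 then x else y.
have vE x y : (v x y 0 0 = x) * (v x y 1 0 = y) by rewrite !mxE.
have [q10|] := eqVneq (cubic (v 1 0)) 0; last by exists (v 1 0).
have [q01|] := eqVneq (cubic (v 0 1)) 0; last by exists (v 0 1).
have [q11|] := eqVneq (cubic (v 1 1)) 0; last by exists (v 1 1).
exists (v 1 (- 1)); apply: contraNneq nz_disc => q1N.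
rewrite /cubic !vE in q10 q01 q11 q1N.
have A0 : A = 0 by rewrite -q10; ring.
have D0 : D = 0 by rewrite -q01; ring.
have C0 : C = 0.
  by apply: (mulfI nz2); rewrite mulr0 -[RHS](addr0 0) -{1}q11 -q1N A0 D0; ring.
by rewrite /disc /cubic_disc A0 C0 D0; apply/eqP; ring.
Qed.

(** A common zero of the cubic and its Hessian is a multiple root: complete
    [v] to a basis [(v, w)]; there the first two coefficients of the cubic
    vanish, and so does its discriminant. *)
Lemma root_hessian_neq0 v : v != 0 -> cubic v = 0 -> hessian v != 0.
Proof.
move=> nz_v q0; have [w nz_vw] := wedge_neq0 nz_v.
set k := wedge v w in nz_vw; apply: contraNneq nz_disc => hes0.
have B'0 : dcubic v w = 0.
  apply/eqP; suff : dcubic v w ^+ 2 == 0 by rewrite expf_eq0.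
  have -> : dcubic v w ^+ 2 = 3 * cubic v * dcubic w v - k ^+ 2 * hessian v.
    by rewrite /k; expand; ring.
  by apply/eqP; rewrite q0 hes0; ring.
suff : k ^+ 6 * disc = 0.
  by move=> /eqP; rewrite mulf_eq0 expf_eq0 /= (negPf nz_vw).
have -> : k ^+ 6 * disc = 18 * cubic v * dcubic v w * dcubic w v * cubic w
  + dcubic v w ^+ 2 * dcubic w v ^+ 2 - 4 * cubic v * dcubic w v ^+ 3
  - 4 * dcubic v w ^+ 3 * cubic w - 27 * cubic v ^+ 2 * cubic w ^+ 2.
  by rewrite /k; expand; ring.
by rewrite q0 B'0; ring.
Qed.

Lemma root_covG_neq0 v : v != 0 -> cubic v = 0 -> covG v != 0.
Proof.
move=> nz_v q0; apply: contra_neq (root_hessian_neq0 nz_v q0) => cov0.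
have := syzygy v; rewrite cov0 q0 !expr0n /= mulr0 addr0 => /esym/eqP.
rewrite mulf_eq0 expf_eq0 /= oppr_eq0.
by have -> : 4 = 2 * 2 :> F by [ring]; rewrite mulf_eq0 (negPf nz2) => /eqP.
Qed.

(** * Endomorphisms rescaling a cubic by their determinant *)

Definition cubic_aut g :=
  \det g != 0 /\ forall v, cubic (g *m v) = \det g * cubic v.

Lemma cubic_aut1 : cubic_aut 1%:M.
Proof. by split=> [|v]; rewrite det1 ?oner_eq0 // mul1mx mul1r. Qed.

Lemma cubic_autM g h : cubic_aut g -> cubic_aut h -> cubic_aut (g *m h).
Proof.
move=> [nz_g qg] [nz_h qh]; split=> [|v]; first by rewrite det_mulmx mulf_neq0.
by rewrite -mulmxA qg qh det_mulmx mulrA.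
Qed.

Lemma cubic_aut_coef g : cubic_aut g ->
  let u := col 0 g in let v := col 1 g in
  [/\ cubic u = \det g * A, dcubic u v = \det g * B,
      dcubic v u = \det g * C & cubic v = \det g * D].
Proof.
case=> _ qg u v; apply: (binary_cubic_eq nz2) => x y.
transitivity (\det g * cubic (\col_i if i == 0 then x else y)).
  by rewrite -qg /cubic /dcubic !mulmx2E !mxE /=; ring.
by rewrite /cubic !mxE /=; ring.
Qed.

(** The Hessian of [q o g] is [det(g)^2] times the Hessian of [q] composed with
    [g], and the Hessian of [det(g) q] is [det(g)^2] times that of [q]. *)
Lemma cubic_aut_hess_mx g : cubic_aut g -> g^T *m hess_mx *m g = hess_mx.
Proof.
move=> aut_g; have [nz_g _] := aut_g; have [a b c d] := cubic_aut_coef aut_g.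
set k := \det g in nz_g a b c d.
set u := col 0 g in a b c d; set v := col 1 g in a b c d.
have nz_k2 : k ^+ 2 != 0 by rewrite expf_neq0.
have u0 : u 0 0 = g 0 0 by rewrite mxE.
have u1 : u 1 0 = g 1 0 by rewrite mxE.
have v0 : v 0 0 = g 0 1 by rewrite mxE.
have v1 : v 1 0 = g 1 1 by rewrite mxE.
have e0 : hessian u = hess0.
  apply: (mulfI nz_k2).
  have -> : k ^+ 2 * hessian u = 3 * cubic u * dcubic v u - dcubic u v ^+ 2.
    by rewrite /k; expand; ring.
  by rewrite a b c /hess0; ring.
have e2 : hessian v = hess2.
  apply: (mulfI nz_k2).
  have -> : k ^+ 2 * hessian v = 3 * dcubic u v * cubic v - dcubic v u ^+ 2.
    by rewrite /k; expand; ring.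
  by rewrite b c d /hess2; ring.
have e1 : 2 * hess0 * (u 0 0 * v 0 0) + hess1 * (u 0 0 * v 1 0 + u 1 0 * v 0 0)
    + 2 * hess2 * (u 1 0 * v 1 0) = hess1.
  apply: (mulfI nz_k2).
  have -> : k ^+ 2 * (2 * hess0 * (u 0 0 * v 0 0)
      + hess1 * (u 0 0 * v 1 0 + u 1 0 * v 0 0) + 2 * hess2 * (u 1 0 * v 1 0))
    = 9 * cubic u * cubic v - dcubic u v * dcubic v u.
    by rewrite /k; expand; ring.
  by rewrite a b c d /hess1; ring.
rewrite /hessian u0 u1 v0 v1 in e0 e1 e2.
apply: mx2P; rewrite !mulmx2E !mx22E !mxE.
- by rewrite -[in RHS]e0; ring.
- by rewrite -[RHS]e1; ring.
- by rewrite -[RHS]e1; ring.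
- by rewrite -[in RHS]e2; ring.
Qed.

(** [J] is the quotient of the Hessian form, which [g] preserves, by the
    symplectic form, which [g] multiplies by [det(g)]. *)
Lemma cubic_aut_hessJ g : cubic_aut g -> g *m hessJ = \det g *: (hessJ *m g).
Proof.
move/cubic_aut_hess_mx=> Mg.
have gSg : g *m symp *m g^T = \det g *: symp.
  by apply: mx2P; rewrite det2E !mxE ?sum2E !mxE ?sum2E ?mx22E ?mxE /=; ring.
by rewrite /hessJ -{1}Mg !mulmxA gSg -!mulmxA -scalemxAl.
Qed.

Lemma cubic_aut_det g : cubic_aut g -> \det g = 1 \/ \det g = - 1.
Proof.
move/cubic_aut_hess_mx/(congr1 (fun M : 'M_2 => \det M)).
rewrite !det_mulmx det_tr det_hess_mx => e.
have nz : 3 * disc != 0 by rewrite mulf_neq0.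
have /eqP : \det g ^+ 2 = 1 by apply: (mulfI nz); rewrite mulr1 -[RHS]e; ring.
by rewrite sqrf_eq1 => /orP[]/eqP; [left|right].
Qed.

(** In an eigenbasis of [J], the diagonal matrix of the two primitive cube roots
    of unity when [dl^2 = disc], since then [(J/dl)^2 = -3]. *)
Definition rho dl := (- 2^-1)%:M + (2 * dl)^-1 *: hessJ.

(** The endomorphism [J] is not a scalar, so its commutant is the algebra it
    generates. *)
Lemma hessJ_comm g : g *m hessJ = hessJ *m g ->
  exists al be, g = al%:M + be *: hessJ.
Proof.
move=> gJ; pose p := g 0 0; pose r := g 0 1; pose s := g 1 0; pose t := g 1 1.
pose j := - 3 * disc.
have nz_j : j != 0 by rewrite mulf_neq0 ?oppr_eq0.
have jE : j = hess1 ^+ 2 - 4 * hess0 * hess2 by rewrite /j; expand; ring.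
have E (i k : 'I_2) := congr1 (fun M : 'M[F]_2 => M i k) gJ.
have := E 0 0; have := E 0 1; have := E 1 0.
rewrite hessJE !mulmx2E !mx22E -/p -/r -/s -/t {E} => E10 E01 E00.
have h0r : hess0 * r = - hess2 * s.
  apply: (mulfI nz2).
  transitivity (p * hess1 - (p * hess1 + r * - (2 * hess0))); first by ring.
  by rewrite E00; ring.
have h1r : hess1 * r = hess2 * (p - t).
  apply: (mulfI nz2).
  transitivity (hess1 * r + p * (2 * hess2)
    - (p * (2 * hess2) + r * - hess1)); first by ring.
  by rewrite E01; ring.
have h1s : hess1 * s = - hess0 * (p - t).
  apply: (mulfI nz2).
  transitivity (s * hess1 + 2 * hess0 * t + (s * hess1 + t * - (2 * hess0)));
    first by ring.
  by rewrite E10; ring.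
(* The numerator is the trace of [g J], and [2 j] is the trace of [J^2]. *)
pose be := (hess1 * (p - t) - 2 * hess0 * r + 2 * hess2 * s) / (2 * j).
exists ((p + t) / 2), be.
have jr : j * r = j * (2 * be * hess2).
  have -> : j * (2 * be * hess2) =
     hess1 * (hess2 * (p - t)) - 2 * hess2 * (hess0 * r) + 2 * hess2 ^+ 2 * s.
    by rewrite /be; field; rewrite nz_j nz2.
  rewrite -h1r h0r jE.
  transitivity (hess1 ^+ 2 * r - 4 * hess2 * (hess0 * r)); first by ring.
  by rewrite h0r; ring.
have js : j * s = j * (- 2 * be * hess0).
  have -> : j * (- 2 * be * hess0) =
     hess1 * (- hess0 * (p - t)) + 2 * hess0 * (hess0 * r)
     - 2 * hess0 * hess2 * s.
    by rewrite /be; field; rewrite nz_j nz2.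
  by rewrite -h1s h0r jE; ring.
have jpt : j * (p - t) = j * (2 * be * hess1).
  have -> : j * (2 * be * hess1) = hess1 ^+ 2 * (p - t)
      - 2 * hess0 * (hess1 * r) + 2 * hess2 * (hess1 * s).
    by rewrite /be; field; rewrite nz_j nz2.
  by rewrite h1r h1s jE; ring.
move/(mulfI nz_j): jr => rE; move/(mulfI nz_j): js => sE.
move/(mulfI nz_j): jpt => ptE.
have ptE2 : be * hess1 = (p - t) / 2 by rewrite ptE; field.
rewrite -hessJE pencilE ptE2; apply: mx2P; rewrite !mx22E -/p -/r -/s -/t //;
  by rewrite ?rE ?sE; field.
Qed.

(** Write [g = al + be J] and let [z] be its eigenvalues, of product 1. The
    relation [q o g = q] forces [z^3 = 1], that is [X = Y = 0] below where
    [X + 1] and [Y] are the coefficients of [g^3] along [1] and [J], up to a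
    factor. *)
Lemma cubic_aut_det1 g : cubic_aut g -> \det g = 1 ->
  g = 1%:M \/ exists2 dl, dl ^+ 2 = disc & g = rho dl.
Proof.
move=> aut_g det_g; have := cubic_aut_hessJ aut_g; rewrite det_g scale1r.
case/hessJ_comm=> al [be gE].
have detE : al ^+ 2 + 3 * be ^+ 2 * disc = 1.
  by rewrite -[RHS]det_g gE pencilE; expand; ring.
pose X := al ^+ 3 - 9 * al * be ^+ 2 * disc - 1.
pose Y := al ^+ 2 * be - be ^+ 3 * disc.
have XY v : X * cubic v + Y * covG v = 0.
  have [_ /(_ v)] := aut_g; rewrite det_g gE mulmxDl mul_scalar_mx -scalemxAl.
  rewrite cubic_pencil mul1r => e; rewrite /X mulrBl mul1r -[X in _ - X]e /Y.
  by rewrite addrAC subrr.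
have [v nz_v] := cubic_ex.
(* The relation [XY] at [v] and at [J v] is a linear system in the values of
   [cubic] and [covG] at [v], whose determinant must vanish. *)
have XY2 : X ^+ 2 + 27 * disc * Y ^+ 2 = 0.
  apply: (mulIf nz_v); rewrite mul0r.
  have e1 := XY v; have := XY (hessJ *m v).
  rewrite cubic_hessJ covG_hessJ => e2.
  apply: (mulfI nz_disc); rewrite mulr0.
  transitivity (disc * X * (X * cubic v + Y * covG v)
    + Y * (X * (- disc * covG v) + Y * (27 * disc ^+ 2 * cubic v)));
    first by ring.
  by rewrite e1 e2 !mulr0 addr0.
(* The norm of [g^3] is [det(g)^3 = 1], which compared with [XY2] yields [X]. *)
have X0 : X = 0.
  apply: (mulfI nz2); rewrite mulr0.
  transitivity ((X + 1) ^+ 2 + 27 * disc * Y ^+ 2 - 1); last first.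
    have -> : (X + 1) ^+ 2 + 27 * disc * Y ^+ 2 =
        (al ^+ 2 + 3 * be ^+ 2 * disc) ^+ 3.
      by rewrite /X /Y; ring.
    by rewrite detE; ring.
  transitivity ((X ^+ 2 + 27 * disc * Y ^+ 2) + 2 * X); last by ring.
  by rewrite XY2 add0r.
have bd : 3 * (be ^+ 2 * disc) = 1 - al ^+ 2 by rewrite -[1 in RHS]detE; ring.
have : (al - 1) * (2 * al + 1) ^+ 2 = 0.
  rewrite -X0 /X.
  have -> : al ^+ 3 - 9 * al * be ^+ 2 * disc
    = al ^+ 3 - 3 * al * (3 * (be ^+ 2 * disc)) by ring.
  by rewrite bd; ring.
move/eqP; rewrite mulf_eq0 subr_eq0 expf_eq0 /=; case/orP=> [/eqP al1|al2].
  left; suff be0 : be = 0 by rewrite gE be0 al1 scale0r addr0.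
  have /eqP : 3 * disc * be ^+ 2 = 0 by rewrite mulrAC -mulrA bd al1; ring.
  by rewrite mulf_eq0 expf_eq0 /= mulf_eq0 (negPf nz3) (negPf nz_disc) => /eqP.
have alE : al = - 2^-1.
  by apply: (mulfI nz2); rewrite mulrN divff //; apply/eqP; rewrite -addr_eq0.
have nz4 : 4 != 0 :> F by rewrite (natrM _ 2 2) mulf_neq0.
have bd1 : 4 * be ^+ 2 * disc = 1.
  apply: (mulfI nz3); transitivity (4 * (3 * (be ^+ 2 * disc))); first by ring.
  by rewrite bd alE; field.
have nz_be : be != 0.
  apply: contra_eq_neq bd1 => ->.
  by rewrite expr0n /= mulr0 mul0r eq_sym oner_eq0.
right; exists ((2 * be)^-1).
  apply: (mulfI (expf_neq0 2 nz_be)); apply: (mulfI nz4).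
  by rewrite [RHS]mulrA bd1; field; rewrite nz_be nz2.
by rewrite gE alE /rho; congr (_ + _ *: _); field; rewrite nz_be nz2 oner_eq0.
Qed.

Section Rotation.
Variable dl : F.
Hypothesis dl2 : dl ^+ 2 = disc.

Let nz_dl : dl != 0.
Proof. by apply: contra_neq nz_disc => dl0; rewrite -dl2 dl0 expr0n. Qed.

Lemma det_rho : \det (rho dl) = 1.
Proof.
have -> : \det (rho dl) = (2^-1) ^+ 2 + 3 * (2 * dl)^-1 ^+ 2 * disc.
  by rewrite /rho pencilE; expand; ring.
by rewrite -dl2; field; rewrite ?nz_dl ?nz2 ?oner_eq0.
Qed.

Lemma rho_aut : cubic_aut (rho dl).
Proof.
split=> [|v]; first by rewrite det_rho oner_eq0.
rewrite det_rho mulmxDl mul_scalar_mx -scalemxAl cubic_pencil -dl2.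
by field; rewrite ?nz_dl ?nz2 ?oner_eq0.
Qed.

Lemma rhoN : rho (- dl) = - 1%:M - rho dl.
Proof.
rewrite /rho mulrN invrN scaleNr opprD addrA; congr (_ - _).
by rewrite -raddfN -raddfB; congr (_%:M); field.
Qed.

Lemma rho_sqr : rho dl *m rho dl = rho (- dl).
Proof.
rewrite /rho pencilM -dl2; congr (_%:M + _ *: _); field;
  by rewrite ?oppr_eq0 ?nz_dl ?nz2 ?oner_eq0.
Qed.

End Rotation.

(** The square has determinant 1; if it were some [rho dl], then [g], which
    commutes with its square, would commute with [J], while
    [g J = - J g]. *)
Lemma cubic_aut_detN1 g : cubic_aut g -> \det g = - 1 -> g *m g = 1%:M.
Proof.
move=> aut_g det_g; have aut_gg := cubic_autM aut_g aut_g.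
have det_gg : \det (g *m g) = 1 by rewrite det_mulmx det_g mulrNN mulr1.
case: (cubic_aut_det1 aut_gg det_gg) => // [[dl dl2 ggE]].
have nz_dl : dl != 0.
  by apply: contra_neq nz_disc => dl0; rewrite -dl2 dl0 expr0n.
have /eqP : (2 * dl)^-1 *: (g *m hessJ) = (2 * dl)^-1 *: (hessJ *m g).
  have := mulmxA g g g; rewrite ggE /rho mulmxDl mulmxDr.
  by rewrite mul_scalar_mx mul_mx_scalar -scalemxAl -scalemxAr => /addrI.
have nz_2dl : (2 * dl)^-1 != 0 by rewrite invr_eq0 mulf_neq0.
rewrite (inj_eq (scalerI nz_2dl)) (cubic_aut_hessJ aut_g) det_g scaleN1r.
rewrite eq_sym -subr_eq0 opprK -mulr2n -scaler_nat scaler_eq0 (negPf nz2) /=.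
move=> /eqP Jg; have := congr1 (mulmx hessJ) Jg.
rewrite mulmxA hessJ_sq mulmx0 mul_scalar_mx => /eqP.
rewrite scaler_eq0 mulf_eq0 oppr_eq0 (negPf nz3) (negPf nz_disc) /= => /eqP g0.
by have := proj1 aut_g; rewrite g0 det0 eqxx.
Qed.

(** A fixed vector [v] is a root because [q(v) = q(gv) = - q(v)]. *)
Lemma cubic_aut_fixed_root g : cubic_aut g -> \det g = - 1 ->
  exists v, [/\ v != 0, g *m v = v & cubic v = 0].
Proof.
move=> aut_g det_g; have gg := cubic_aut_detN1 aut_g det_g.
have [i nz_i] : exists i, col i (1%:M + g) != 0.
  apply/existsP; apply: contraT; rewrite negb_exists => /forallP c0.
  have : 1%:M + g = 0.
    by apply/matrixP=> i j; have /negPn/eqP/colP/(_ i) := c0 j; rewrite !mxE.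
  move/eqP; rewrite addrC addr_eq0 => /eqP gN.
  have := det_g; rewrite gN -scaleN1r detZ det1 mulr1 sqrrN expr1n => /eqP.
  by rewrite -addr_eq0 (negPf nz2).
have gv : g *m col i (1%:M + g) = col i (1%:M + g).
  by rewrite !colE mulmxA mulmxDr mulmx1 gg addrC.
exists (col i (1%:M + g)); split=> //.
have := proj2 aut_g (col i (1%:M + g)); rewrite gv det_g mulN1r => /eqP.
by rewrite -addr_eq0 -mulr2n -mulr_natl mulf_eq0 (negPf nz2) => /eqP.
Qed.

Lemma dcubic_polar v w :
  2 * dcubic v w = cubic (v + w) - cubic (v - w) - 2 * cubic w.
Proof. by expand; ring. Qed.

Lemma cubic_aut_covG g v : cubic_aut g -> covG (g *m v) = covG v.
Proof.
move=> aut_g; have dE w : dcubic (g *m v) (g *m w) = \det g * dcubic v w.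
  apply: (mulfI nz2); rewrite mulrCA !dcubic_polar -mulmxDr -mulmxBr.
  by rewrite !(proj2 aut_g); ring.
have det2 : \det g * \det g = 1.
  by case: (cubic_aut_det aut_g) => ->; rewrite ?mulrNN mulr1.
rewrite /covG -[hessJ *m _]scale1r -det2 -scalerA mulmxA scalemxAl.
rewrite -(cubic_aut_hessJ aut_g) -mulmxA.
have -> : dcubic (g *m v) (\det g *: (g *m (hessJ *m v))) =
    \det g * dcubic (g *m v) (g *m (hessJ *m v)).
  by rewrite /dcubic !mxE; ring.
by rewrite dE mulrA det2 mul1r.
Qed.

Lemma covGN v : covG (- v) = - covG v.
Proof. by expand; ring. Qed.

(** The map negating [v] and fixing the line on which the polar form
    [dcubic v] vanishes; in a basis adapted to it, [covG v = 0] kills the one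
    coefficient of the cubic that could violate [q o g = - q]. *)
Lemma reflection v : v != 0 -> covG v = 0 ->
  exists g, [/\ cubic_aut g, \det g = - 1, g *m v = - v &
                forall lam : 'rV_2, lam *m v = 0 -> lam *m g = lam].
Proof.
move=> nz_v G0; have nz_q : cubic v != 0.
  by apply: contra_eq_neq G0 => /root_covG_neq0; apply.
pose n := 3 * cubic v; have nz_n : n != 0 by rewrite mulf_neq0.
pose grad : 'rV[F]_2 := \row_i dcubic v (col i 1%:M).
have gradE w : grad *m w = (dcubic v w)%:M.
  apply/matrixP=> i j; rewrite !ord1 mulmx2E !mxE /dcubic !mxE /= mulr1n.
  by ring.
pose g := 1%:M - (2 / n) *: (v *m grad).
have gE w : g *m w = w - (2 / n * dcubic v w) *: v.
  by rewrite mulmxBl mul1mx -scalemxAl -mulmxA gradE mul_mx_scalar scalerA.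
have dvv : dcubic v v = n by rewrite /n; expand; ring.
have det_g : \det g = - 1.
  transitivity (1 - 2 / n * dcubic v v); last by rewrite dvv; field.
  rewrite /g det2E !mxE !big_ord1 !mxE /dcubic !mxE /=; ring.
exists g; split=> //; first last.
- move=> lam lam0; rewrite mulmxBr mulmx1 -scalemxAr mulmxA lam0 mul0mx.
  by rewrite scaler0 subr0.
- by rewrite gE dvv divfK // scaler_nat mulr2n opprD addrA subrr sub0r.
split=> [|w]; first by rewrite det_g oppr_eq0 oner_eq0.
have nz_n3 : n ^+ 3 != 0 by rewrite expf_neq0.
apply: (mulfI nz_n3); rewrite -cubicZ gE scalerBr scalerA.
have -> : n * (2 / n * dcubic v w) = 2 * dcubic v w by field.
rewrite det_g mulN1r mulrN; apply/eqP; rewrite -addr_eq0; apply/eqP.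
transitivity (2 * cubic v * covG v * wedge v w ^+ 3); last first.
  by rewrite G0 mulr0 mul0r.
by rewrite /n; expand; ring.
Qed.

(** * Stabilizers of a linear form *)

Section Stabilizer.
Variable lam : 'rV[F]_2.

Definition aut_mx g := cubic_aut g /\ lam *m g = lam.

Lemma aut_mxM g h : aut_mx g -> aut_mx h -> aut_mx (g *m h).
Proof.
by move=> [ag lg] [ah lh]; split; [exact: cubic_autM | rewrite mulmxA lg lh].
Qed.

Lemma aut_mx_trivial : (forall g, aut_mx g -> g = 1%:M) ->
  mx_isomorphic_to aut_mx 'I_1.
Proof.
move=> triv; apply: (@cyclic_mx_iso _ _ 1); rewrite ?expr1n //.
  by case.
move=> h; split=> [/triv ->|[i <-]]; first by exists 0.
by rewrite expr1n; split; [exact: cubic_aut1 | rewrite mulmx1].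
Qed.

(** Two elements of determinant -1 have a product of determinant 1, so [s] is
    the only one. *)
Lemma aut_mx_involution s : (forall g, aut_mx g -> \det g = 1 -> g = 1%:M) ->
  aut_mx s -> \det s = - 1 -> mx_isomorphic_to aut_mx 'I_2.
Proof.
move=> triv aut_s det_s; have ss := cubic_aut_detN1 (proj1 aut_s) det_s.
have nz1N : 1 != - 1 :> F by rewrite -addr_eq0.
apply: (@cyclic_mx_iso _ _ s); first by rewrite expr2.
  case=> [|[|]] // _; apply: contra_neq nz1N => s1.
  by rewrite -det_s -[s]expr1 s1 det1.
move=> h; split=> [aut_h|[i <-]]; last first.
  elim/ord2P: i => //; rewrite expr0.
  by split; [exact: cubic_aut1 | rewrite mulmx1].
case: (cubic_aut_det (proj1 aut_h)) => det_h.
  by exists 0; rewrite expr0 [RHS]triv.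
have sh : s *m h = 1%:M.
  by apply: triv; [exact: aut_mxM | rewrite det_mulmx det_h det_s mulrNN mulr1].
by exists 1; rewrite expr1 -[h]mul1mx -ss -mulmxA sh mulmx1.
Qed.

(** If [r] denotes [rho dl], then [1 + r + r^2 = 0], so a form fixed by [r]
    is killed by 3. *)
Lemma rho_fix dl : dl ^+ 2 = disc -> lam *m rho dl = lam -> lam = 0.
Proof.
move=> dl2 fix_l; have : 3 *: lam = 0.
  have : lam *m (rho dl *m rho dl) = lam by rewrite mulmxA !fix_l.
  rewrite rho_sqr // rhoN // mulmxBr mulmxN mulmx1 fix_l => e.
  have -> : 3 = 1 + 1 + 1 :> F by ring.
  by rewrite !scalerDl scale1r -{3}e addrA addrK subrr.
by move/eqP; rewrite scaler_eq0 (negPf nz3) => /eqP.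
Qed.

End Stabilizer.

Section NonzeroTrace.
Variable lam : 'rV[F]_2.
Hypothesis nz_lam : lam != 0.
(* The vector with [wedge tau v = lam v]. *)
Let tau : 'cV[F]_2 := \col_i if i == 0 then lam 0 1 else - lam 0 0.

Let nz_tau : tau != 0.
Proof.
apply: contra_neq nz_lam => tau0; apply/rowP.
have E i := congr1 (fun v : 'cV_2 => v i 0) tau0.
elim/ord2P; rewrite mxE; last by have := E 0; rewrite !mxE.
by have /eqP := E 1; rewrite !mxE /= oppr_eq0 => /eqP.
Qed.

Lemma aut_mx_det1 g : aut_mx lam g -> \det g = 1 -> g = 1%:M.
Proof.
move=> [aut_g lam_g] /(cubic_aut_det1 aut_g)[//|[dl dl2 gE]].
by case/eqP: nz_lam; apply: (rho_fix dl2); rewrite -gE.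
Qed.

Lemma aut_mx_tau g : lam *m g = lam -> g *m tau = \det g *: tau.
Proof.
move=> lam_g; have E i := congr1 (fun v : 'rV_2 => v 0 i) lam_g.
have := E 0; have := E 1; rewrite !mulmx2E => E1 E0.
have tauE : (tau 0 0 = lam 0 1) * (tau 1 0 = - lam 0 0) by rewrite !mxE.
apply: cv2P; rewrite [RHS]mxE mulmx2E det2E !tauE.
  transitivity (g 0 0 * (lam 0 0 * g 0 1 + lam 0 1 * g 1 1)
    - g 0 1 * (lam 0 0 * g 0 0 + lam 0 1 * g 1 0)); last by ring.
  by rewrite E0 E1; ring.
transitivity (g 1 0 * (lam 0 0 * g 0 1 + lam 0 1 * g 1 1)
  - g 1 1 * (lam 0 0 * g 0 0 + lam 0 1 * g 1 0)); last by ring.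
by rewrite E0 E1; ring.
Qed.

(** An involution would negate [tau], and [covG] is an odd invariant function
    of its argument. *)
Lemma aut_mx_generic : covG tau != 0 -> mx_isomorphic_to (aut_mx lam) 'I_1.
Proof.
move=> nz_G; apply: aut_mx_trivial => g aut_g; have [cg lg] := aut_g.
case: (cubic_aut_det cg) => det_g; first exact: aut_mx_det1.
case/eqP: nz_G; apply: (mulfI nz2); rewrite mulr0.
have := cubic_aut_covG tau cg; rewrite aut_mx_tau // det_g scaleN1r covGN => e.
by rewrite mulr_natl mulr2n -{1}e addNr.
Qed.

Lemma aut_mx_special : covG tau = 0 -> mx_isomorphic_to (aut_mx lam) 'I_2.
Proof.
move=> G0; have [s [cs det_s _ lam_s]] := reflection nz_tau G0.
apply: (aut_mx_involution aut_mx_det1 _ det_s); split=> //; apply: lam_s.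
by apply/matrixP=> i j; rewrite !ord1 mulmx2E !mxE /=; ring.
Qed.

End NonzeroTrace.

Section ZeroTrace.

Lemma aut_mx0 g : aut_mx 0 g <-> cubic_aut g.
Proof. by split=> [[]//|cg]; split=> //; rewrite mul0mx. Qed.

Let no_root := forall v, cubic v = 0 -> v = 0.
Let no_sqrt := forall dl, dl ^+ 2 != disc.

Lemma cubic_aut_no_sqrt g : no_sqrt -> cubic_aut g -> \det g = 1 -> g = 1%:M.
Proof.
by move=> nosq cg /(cubic_aut_det1 cg)[//|[dl /eqP]]; rewrite (negPf (nosq dl)).
Qed.

Lemma cubic_aut_no_root g : no_root -> cubic_aut g -> \det g = 1.
Proof.
move=> noroot cg; case: (cubic_aut_det cg) => // /(cubic_aut_fixed_root cg).
by case=> v [/eqP nz_v _ /noroot].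
Qed.

Lemma aut_mx_noroot_nosqrt : no_root -> no_sqrt ->
  mx_isomorphic_to (aut_mx 0) 'I_1.
Proof.
move=> noroot nosq; apply: aut_mx_trivial => g /aut_mx0 cg.
exact/cubic_aut_no_sqrt/cubic_aut_no_root.
Qed.

(** The reflection negating [J r]: it anticommutes with [J], so it fixes
    [J^2 r], a multiple of [r]. *)
Lemma root_involution r : r != 0 -> cubic r = 0 ->
  exists s, [/\ cubic_aut s, \det s = - 1 & s *m r = r].
Proof.
move=> nz_r q0.
have JJ v : hessJ *m (hessJ *m v) = (- 3 * disc) *: v.
  by rewrite mulmxA hessJ_sq mul_scalar_mx.
have nz_j : - 3 * disc != 0 by rewrite mulf_neq0 ?oppr_eq0.
have nz_Jr : hessJ *m r != 0.
  apply: contra_neq nz_r => Jr0; apply: (scalerI nz_j).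
  by rewrite -JJ Jr0 mulmx0 scaler0.
have [|s [cs det_s sJr _]] := reflection nz_Jr.
  by rewrite covG_hessJ q0 mulr0.
exists s; split=> //; apply: (scalerI nz_j).
have Js : hessJ *m s = - (s *m hessJ).
  by rewrite (cubic_aut_hessJ cs) det_s scaleN1r opprK.
rewrite -!JJ [hessJ *m (s *m r)]mulmxA Js mulNmx -[s *m hessJ *m r]mulmxA.
by rewrite sJr opprK.
Qed.

Lemma aut_mx_root_nosqrt r : r != 0 -> cubic r = 0 -> no_sqrt ->
  mx_isomorphic_to (aut_mx 0) 'I_2.
Proof.
move=> nz_r q0 nosq; have [s [cs det_s _]] := root_involution nz_r q0.
apply: (aut_mx_involution _ _ det_s); last exact/aut_mx0.
by move=> g /aut_mx0; apply: cubic_aut_no_sqrt.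
Qed.

Section SquareRootOfDiscriminant.
Variable dl : F.
Hypothesis dl2 : dl ^+ 2 = disc.
Let ro := rho dl.

Lemma rho_cube : ro *m ro *m ro = 1%:M.
Proof.
rewrite rho_sqr // rhoN // mulmxBl mulNmx mul1mx rho_sqr // rhoN //.
by rewrite opprB addKr opprK.
Qed.

Lemma rho_neq1 : ro != 1%:M.
Proof.
apply/eqP => e; have := rho_fix (lam := const_mx 1) dl2.
rewrite -/ro e mulmx1 => /(_ erefl) /matrixP /(_ 0 0); rewrite !mxE => /eqP.
by rewrite oner_eq0.
Qed.

Lemma cubic_aut_rot g : cubic_aut g -> \det g = 1 ->
  [\/ g = 1%:M, g = ro | g = ro *m ro].
Proof.
move=> cg /(cubic_aut_det1 cg)[->|[d d2 ->]]; first by constructor 1.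
have /eqP : d ^+ 2 = dl ^+ 2 by rewrite d2.
rewrite eqf_sqr => /orP[] /eqP ->; first by constructor 2.
by constructor 3; rewrite rho_sqr.
Qed.

Lemma aut_mx_noroot_sqrt : no_root -> mx_isomorphic_to (aut_mx 0) 'I_3.
Proof.
move=> noroot; apply: (@cyclic_mx_iso _ _ ro 2).
- by rewrite !exprS expr0 mulr1; exact: etrans (mulmxA _ _ _) rho_cube.
- case=> [|[|[|]]] // _; first exact: rho_neq1.
  rewrite expr2; apply: contra_neq rho_neq1 => e.
  by have := rho_cube; rewrite [ro *m ro]e mul1mx.
move=> h; rewrite aut_mx0; split=> [ch|[i <-]].
  have [] := cubic_aut_rot ch (cubic_aut_no_root noroot ch) => ->.
  - by exists (inord 0); rewrite inordK.
  - by exists (inord 1); rewrite inordK.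
  by exists (inord 2); rewrite inordK.
elim: (i : nat) => [|n IHn]; first exact: cubic_aut1.
by rewrite exprS; apply: cubic_autM IHn; apply: rho_aut.
Qed.

Section ThreeRoots.
Variable r : 'cV[F]_2.
Hypotheses (nz_r : r != 0) (r_root : cubic r = 0).

(* Vectors on the three root lines, of sum zero; the group permutes the vectors
   themselves and not only the lines. *)
Let w (i : 'I_3) : 'cV[F]_2 := nth 0 [:: r; ro *m r; ro *m ro *m r] i.
Let o0 : 'I_3 := @Ordinal 3 0 isT.
Let o1 : 'I_3 := @Ordinal 3 1 isT.
Let o2 : 'I_3 := @Ordinal 3 2 isT.

Let ord3P (P : 'I_3 -> Prop) : P o0 -> P o1 -> P o2 -> forall i, P i.
Proof.
move=> P0 P1 P2 [[|[|[|//]]] lt_i].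
- by have -> : Ordinal lt_i = o0 by apply: val_inj.
- by have -> : Ordinal lt_i = o1 by apply: val_inj.
by have -> : Ordinal lt_i = o2 by apply: val_inj.
Qed.

Let sum3E (f : 'I_3 -> 'cV[F]_2) : \sum_i f i = f o0 + f o1 + f o2.
Proof.
rewrite !big_ord_recl big_ord0 addr0 addrA.
by congr (f _ + f _ + f _); apply: val_inj.
Qed.

Let sum_w : w o0 + w o1 + w o2 = 0.
Proof.
rewrite /w /= rho_sqr // rhoN // mulmxBl mulNmx mul1mx addrA -/ro.
by rewrite addrAC addrK subrr.
Qed.

Let w2 : w o2 = - w o0 - w o1.
Proof. by apply/eqP; rewrite -opprD -addr_eq0 addrC sum_w. Qed.

Let ro_w i : exists j, ro *m w i = w j.
Proof.
elim/ord3P: i; [exists o1 | exists o2 | exists o0]; rewrite /w /= ?mulmxA //.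
by rewrite rho_cube mul1mx.
Qed.

Let wedge_w01 : wedge (w o0) (w o1) != 0.
Proof.
have nz_dl : dl != 0.
  by apply: contra_neq nz_disc => dl0; rewrite -dl2 dl0 expr0n.
have -> : wedge (w o0) (w o1) = - (dl^-1 * hessian r).
  rewrite /w /= /ro /rho mulmxDl mul_scalar_mx -scalemxAl.
  have <- : wedge (hessJ *m r) r / 2 = hessian r by rewrite wedge_hessJ; field.
  move: (hessJ *m r) => Jr; rewrite /wedge !mxE.
  by field; rewrite ?nz_dl ?nz2.
by rewrite oppr_eq0 mulf_neq0 ?invr_eq0 // root_hessian_neq0.
Qed.

Let swap_w : exists s, [/\ cubic_aut s, \det s = - 1,
  s *m w o0 = w o0, s *m w o1 = w o2 & s *m w o2 = w o1].
Proof.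
have [s [cs det_s sr]] := root_involution nz_r r_root.
have s0 : s *m w o0 = w o0 by [].
have s1 : s *m w o1 = w o2.
  rewrite /w /= rho_sqr // mulmxA /ro /rho mulmxDr mulmxDl.
  rewrite -scalemxAr (cubic_aut_hessJ cs) det_s scaleN1r.
  rewrite mul_mx_scalar mulmxDl -scalemxAl sr mul_scalar_mx; congr (_ + _).
  by rewrite mulrN invrN scaleNr scalerN !mulNmx -!scalemxAl -mulmxA sr.
exists s; split=> //; rewrite w2 mulmxBr mulmxN s0 s1 w2.
by rewrite opprB opprK addrCA addNr addr0.
Qed.

Let transitive_w i j : i != j ->
  exists g, [/\ cubic_aut g, g *m w o0 = w i & g *m w o1 = w j].
Proof.
have [s [cs _ s0 s1 _]] := swap_w.
have cr := rho_aut dl2; rewrite -/ro in cr.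
have r0 : ro *m w o0 = w o1 by [].
have r1 : ro *m w o1 = w o2 by rewrite /w /= mulmxA.
have r2 : ro *m w o2 = w o0 by rewrite /w /= !mulmxA rho_cube mul1mx.
elim/ord3P: i; elim/ord3P: j => // _.
- by exists 1%:M; rewrite !mul1mx; split=> //; exact: cubic_aut1.
- by exists s; rewrite s0 s1.
- exists (ro *m s); rewrite -!mulmxA s0 s1 r0 r2; split=> //; exact: cubic_autM.
- by exists ro; rewrite r0 r1.
- exists (ro *m ro); rewrite -!mulmxA r0 r1 r2; split=> //; exact: cubic_autM.
- exists (ro *m (ro *m s)); rewrite -!mulmxA s0 s1 r0 r1 r2; split=> //.
  by do 2!apply: cubic_autM => //.
Qed.

Let w_inj : injective w.
Proof.
move=> i j e; apply/eqP/contraT => /transitive_w[g [cg gi gj]].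
case/eqP: wedge_w01.
have Ug : g \in unitmx by rewrite unitmxE unitfE (proj1 cg).
have -> : w o0 = w o1 by rewrite -[LHS](mulKmx Ug) gi e -gj mulKmx.
by rewrite /wedge mulrC subrr.
Qed.

Let basis_mx (u v : 'cV[F]_2) : 'M[F]_2 :=
  \matrix_(i, j) if j == 0 then u i 0 else v i 0.

Let mul_basis_mx g u v : g *m basis_mx u v = basis_mx (g *m u) (g *m v).
Proof. by apply: mx2P; rewrite !mulmx2E !mxE /= !sum2E. Qed.

Let det_basis_mx u v : \det (basis_mx u v) = wedge u v.
Proof. by rewrite det2E !mxE /wedge /= [v 0 0 * _]mulrC. Qed.

Let unit_w : basis_mx (w o0) (w o1) \in unitmx.
Proof. by rewrite unitmxE unitfE det_basis_mx. Qed.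

Let mx_w_inj g h : g *m w o0 = h *m w o0 -> g *m w o1 = h *m w o1 -> g = h.
Proof.
move=> e0 e1; apply: (can_inj (mulmxK unit_w)).
by rewrite !mul_basis_mx e0 e1.
Qed.

(* The inverse turns the composition order of permutations, in which the left
   factor acts first, into that of matrices. *)
Let perm_mx_w (s : 'S_3) : 'M[F]_2 :=
  basis_mx (w (s^-1%g o0)) (w (s^-1%g o1)) *m invmx (basis_mx (w o0) (w o1)).

Let perm_mx_wE s i : perm_mx_w s *m w i = w (s^-1%g i).
Proof.
have e : basis_mx (perm_mx_w s *m w o0) (perm_mx_w s *m w o1) =
    basis_mx (w (s^-1%g o0)) (w (s^-1%g o1)).
  by rewrite -mul_basis_mx mulmxKV.
have E i j := congr1 (fun M : 'M_2 => M i j) e.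
have e0 : perm_mx_w s *m w o0 = w (s^-1%g o0).
  by apply: cv2P; [have := E 0 0 | have := E 1 0]; rewrite !mxE.
have e1 : perm_mx_w s *m w o1 = w (s^-1%g o1).
  by apply: cv2P; [have := E 0 1 | have := E 1 1]; rewrite !mxE.
elim/ord3P: i => //; rewrite w2 mulmxBr mulmxN e0 e1.
have : \sum_i w (s^-1%g i) = 0.
  by rewrite -[RHS]sum_w -sum3E [RHS](reindex_inj (@perm_inj _ s^-1%g)).
by rewrite sum3E => /eqP; rewrite addrC addr_eq0 opprD => /eqP ->.
Qed.

Lemma aut_mx_root_sqrt : mx_isomorphic_to (aut_mx 0) 'S_3.
Proof.
exists perm_mx_w; split.
- move=> s t e; apply: invg_inj; apply/permP => i; apply: w_inj.
  by rewrite -!perm_mx_wE e.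
- move=> g; rewrite aut_mx0; split=> [cg|[s <-]]; last first.
    have [|h [ch h0 h1]] := @transitive_w (s^-1%g o0) (s^-1%g o1).
      by rewrite (inj_eq perm_inj).
    by have -> : perm_mx_w s = h by apply: mx_w_inj; rewrite perm_mx_wE.
  have [s [cs det_s s0 s1 s2]] := swap_w.
  have stab h : cubic_aut h -> \det h = 1 -> forall i, exists j, h *m w i = w j.
    move=> ch det_h i; have [] := cubic_aut_rot ch det_h => ->.
    - by exists i; rewrite mul1mx.
    - exact: ro_w.
    by have [j e] := ro_w i; have [k e'] := ro_w j; exists k; rewrite -mulmxA e.
  have : forall i, exists j, g *m w i = w j.
    case: (cubic_aut_det cg) => det_g; first exact: stab.
    move=> i; have [||j sgi] := stab (s *m g) _ _ i; first exact: cubic_autM.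
      by rewrite det_mulmx det_s det_g mulrNN mulr1.
    have -> : g *m w i = s *m w j.
      by rewrite -sgi !mulmxA (cubic_aut_detN1 cs det_s) mul1mx.
    by elim/ord3P: j {sgi}; [exists o0 | exists o2 | exists o1].
  case/fin_all_exists => p gw.
  have p_inj : injective p.
    move=> i j e; apply: w_inj.
    have Ug : g \in unitmx by rewrite unitmxE unitfE (proj1 cg).
    by rewrite -[LHS](mulKmx Ug) gw e -gw mulKmx.
  exists (perm p_inj)^-1%g; apply: mx_w_inj;
    by rewrite perm_mx_wE invgK permE.
- by move=> s t; apply: mx_w_inj; rewrite -mulmxA !perm_mx_wE invMg permM.
Qed.

End ThreeRoots.
End SquareRootOfDiscriminant.
End ZeroTrace.

End BinaryCubic.

Section BaseChange.
Variables (F K : fieldType) (f : {rmorphism F -> K}) (A B C D : F).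
Implicit Type v : 'cV[F]_2.

Let rmorphE := (rmorph_nat f, rmorphN f, rmorphB f, rmorphD f, rmorphM f,
  rmorphXn f).

Lemma cubic_rmorph v :
  cubic (f A) (f B) (f C) (f D) (map_mx f v) = f (cubic A B C D v).
Proof. by rewrite /cubic !mxE !rmorphE. Qed.

Lemma cubic_disc_rmorph :
  cubic_disc (f A) (f B) (f C) (f D) = f (cubic_disc A B C D).
Proof. by rewrite /cubic_disc !rmorphE. Qed.

Lemma covG_rmorph v :
  covG (f A) (f B) (f C) (f D) (map_mx f v) = f (covG A B C D v).
Proof.
rewrite /covG /dcubic !hessJE !mulmx2E !mx22E !mxE /hess0 /hess1 /hess2.
by rewrite !rmorphE.
Qed.

End BaseChange.

(** * Binary forms as polynomials in two variables *)

Section Homogeneous.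
Variable F : fieldType.
Implicit Types (v : 'cV[F]_2) (p : {mpoly F[2]}).
Local Notation i0 := (ord0 : 'I_2).
Local Notation i1 := (ord_max : 'I_2).
Local Notation X := ('X_i0 : {mpoly F[2]}).
Local Notation Y := ('X_i1 : {mpoly F[2]}).

Definition lin_mpoly (a b : F) : {mpoly F[2]} := a *: X + b *: Y.

Definition cubic_mpoly (a b c d : F) : {mpoly F[2]} :=
  a *: X ^+ 3 + b *: (X ^+ 2 * Y) + c *: (X * Y ^+ 2) + d *: Y ^+ 3.

Lemma lin_mpoly_homog a b : lin_mpoly a b \is 1.-homog.
Proof. by rewrite dhomogD ?dhomogZ // dhomogX /= mdeg1. Qed.

Lemma homog1_lin_mpoly p : p \is 1.-homog ->
  p = lin_mpoly p@_U_(i0) p@_U_(i1).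
Proof.
move=> p_homog; apply/mpolyP=> k; rewrite mcoeffD !mcoeffZ !mcoeffX.
have [/mdeg1P[i /eqP ->]|nz] := boolP (mdeg k == 1%N).
  by rewrite !eq_mnm1; elim/ord2P: i; rewrite /= ?mulr1 ?mulr0 ?addr0 ?add0r //;
   congr (_@_(U_(_))); apply: val_inj.
rewrite (dhomog_nemf_coeff p_homog) //.
do 2!(case: eqP => [e|_]; first by rewrite -e mdeg1 in nz).
by rewrite !mulr0 addr0.
Qed.

Lemma lin_mpolyM3 a b a' b' a'' b'' :
  lin_mpoly a b * lin_mpoly a' b' * lin_mpoly a'' b'' =
  cubic_mpoly (a * a' * a'') (a * a' * b'' + a * b' * a'' + b * a' * a'')
    (a * b' * b'' + b * a' * b'' + b * b' * a'') (b * b' * b'').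
Proof.
rewrite /lin_mpoly /cubic_mpoly -!mul_mpolyC ?(mpolyCM, mpolyCD); ring.
Qed.

Lemma cubic_mpoly_eval a b c d v :
  (cubic_mpoly a b c d).@[fun i => if i == i0 then v 0 0 else v 1 0] =
  cubic a b c d v.
Proof.
rewrite /cubic_mpoly /cubic !(exprS, expr0, mulr1).
by rewrite ?(mevalD, mevalZ, mevalM, mevalXU) /=; ring.
Qed.
End Homogeneous.

Section Eval.
Variables (F : fieldType) (V : vectType F) (m : {bilinear V -> V -> V}).
Variable e : 2.-tuple V.
Local Notation A := (cub_A m e).
Local Notation B := (cub_B m e).
Local Notation C := (cub_C m e).
Local Notation D := (cub_D m e).
Local Notation i0 := (ord0 : 'I_2).
Local Notation i1 := (ord_max : 'I_2).
Local Notation X := ('X_i0 : {mpoly F[2]}).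
Local Notation Y := ('X_i1 : {mpoly F[2]}).

Lemma mderiv_X (i j : 'I_2) : ('X_i : {mpoly F[2]})^`M(j) = (i == j)%:R.
Proof.
rewrite mderivX mnm1E; case: eqP => [<-|_]; last by rewrite scale0r.
rewrite scale1r -mpolyX0; congr 'X_[_].
by apply/mnmP=> k; rewrite mnmBE subnn mnm0E.
Qed.

Definition mpE := (mderivD, mderivB, mderivZ, mderivM, mderiv_X, eqxx).

Definition quad_mpoly (a b c : F) : {mpoly F[2]} :=
  a *: X ^+ 2 + b *: (X * Y) + c *: Y ^+ 2.

Ltac mring := rewrite /quad_mpoly /lin_mpoly ?mpE /=
  -?mul_mpolyC ?(mpolyCM, mpolyCMn, mpolyCD, mpolyCN) ?mpolyC1; ring.

Lemma fund_cubic_d0 : (fund_cubic m e)^`M(i0) = quad_mpoly (3 * A) (2 * B) C.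
Proof. by rewrite /fund_cubic !(exprS, expr0, mulr1); mring. Qed.

Lemma fund_cubic_d1 : (fund_cubic m e)^`M(i1) = quad_mpoly B (2 * C) (3 * D).
Proof. by rewrite /fund_cubic !(exprS, expr0, mulr1); mring. Qed.

Lemma quad_d0 a b c : (quad_mpoly a b c)^`M(i0) = lin_mpoly (2 * a) b.
Proof. by rewrite /quad_mpoly !(exprS, expr0, mulr1); mring. Qed.

Lemma quad_d1 a b c : (quad_mpoly a b c)^`M(i1) = lin_mpoly b (2 * c).
Proof. by rewrite /quad_mpoly !(exprS, expr0, mulr1); mring. Qed.

Lemma cub_muE : cub_mu m e =
  quad_mpoly (4 * hess0 A B C) (4 * hess1 A B C D) (4 * hess2 B C D).
Proof.
rewrite /cub_mu fund_cubic_d0 fund_cubic_d1 !quad_d0 !quad_d1.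
by rewrite /hess0 /hess1 /hess2 !(exprS, expr0, mulr1); mring.
Qed.

Variable u : 'cV[F]_2.
Variable t : 'I_2 -> F.
Hypotheses (t0 : t i0 = u 0 0) (t1 : t i1 = u 1 0).

Ltac meval_simp := rewrite ?(mevalD, mevalN, mevalZ, mevalM, mevalXU, t0, t1).

Lemma fund_cubic_eval : (fund_cubic m e).@[t] = cubic A B C D u.
Proof.
by rewrite /fund_cubic /cubic !(exprS, expr0, mulr1); meval_simp; ring.
Qed.

Lemma cub_mu_eval : (cub_mu m e).@[t] = 4 * hessian A B C D u.
Proof.
rewrite cub_muE /quad_mpoly /hessian !(exprS, expr0, mulr1); meval_simp.
by ring.
Qed.

Lemma cub_G_eval : (cub_G m e).@[t] = 4 * covG A B C D u.
Proof.
rewrite /cub_G cub_muE !quad_d0 !quad_d1 fund_cubic_d0 fund_cubic_d1.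
rewrite /quad_mpoly /lin_mpoly !(exprS, expr0, mulr1); meval_simp.
by rewrite /covG /dcubic hessJE !mulmx2E !mx22E; ring.
Qed.

End Eval.

(** * Coordinates in a basis *)

Section Coordinates.
Variables (F : fieldType) (V : vectType F) (e : 2.-tuple V).
Hypothesis e_basis : basis_of {:V}%VS e.

Definition vec (v : V) : 'cV[F]_2 := \col_i coord e i v.
Definition unvec (u : 'cV[F]_2) : V := u 0 0 *: e`_0 + u 1 0 *: e`_1.

Lemma vecK : cancel vec unvec.
Proof.
move=> v; rewrite {2}(coord_basis e_basis (memvf v)) sum2E /unvec !mxE.
by congr (_ *: _ + _ *: _).
Qed.

Lemma vecP a v w : vec (a *: v + w) = a *: vec v + vec w.
Proof. by apply/colP=> i; rewrite !mxE linearP. Qed.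

Lemma vecZ a v : vec (a *: v) = a *: vec v.
Proof. by apply/colP=> i; rewrite !mxE linearZ. Qed.

Lemma vecD v w : vec (v + w) = vec v + vec w.
Proof. by apply/colP=> i; rewrite !mxE linearD. Qed.

Lemma unvecP a u v : unvec (a *: u + v) = a *: unvec u + unvec v.
Proof.
by rewrite /unvec !mxE !scalerDl !scalerDr !scalerA addrACA.
Qed.

Lemma vec_e0 : vec e`_0 = \col_i (i == 0)%:R.
Proof.
apply/colP=> i; rewrite !mxE; have := coord_free 0 i (basis_free e_basis).
by rewrite /= eq_sym.
Qed.

Lemma vec_e1 : vec e`_1 = \col_i (i == 1)%:R.
Proof.
apply/colP=> i; rewrite !mxE; have := coord_free 1 i (basis_free e_basis).
by rewrite /= eq_sym.
Qed.

Lemma unvecK : cancel unvec vec.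
Proof.
move=> u; rewrite /unvec vecP vecZ vec_e0 vec_e1.
by apply: cv2P; rewrite !mxE /= ?mulr0 ?mulr1 ?add0r ?addr0.
Qed.

Definition mx_of_end (g : 'End(V)) : 'M[F]_2 :=
  \matrix_(i, j) vec (g e`_j) i 0.

Lemma vec_end (g : 'End(V)) v : vec (g v) = mx_of_end g *m vec v.
Proof.
rewrite -{1}[v]vecK /unvec linearP linearZ vecP vecZ.
apply/colP=> i; rewrite mulmx2E; move: (vec v 0 0) (vec v 1 0) => x y.
by rewrite !mxE; ring.
Qed.

Definition end_fun (M : 'M[F]_2) v := unvec (M *m vec v).

Lemma end_fun_linear M : linear (end_fun M).
Proof. by move=> a v w; rewrite /end_fun vecP mulmxDr -scalemxAr unvecP. Qed.

HB.instance Definition _ M :=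
  GRing.isLinear.Build F V V _ (end_fun M) (end_fun_linear M).

Definition end_of_mx M : 'End(V) := linfun (end_fun M).

Lemma end_of_mxE M v : vec (end_of_mx M v) = M *m vec v.
Proof. by rewrite lfunE /= /end_fun unvecK. Qed.

Lemma end_of_mxK : cancel end_of_mx mx_of_end.
Proof.
move=> M; apply/matrixP=> i j; rewrite mxE end_of_mxE mulmx2E.
move: j; elim/ord2P; rewrite ?vec_e0 ?vec_e1 !mxE /=;
  by rewrite ?mulr0 ?mulr1 ?add0r ?addr0.
Qed.

Lemma mx_of_endK : cancel mx_of_end end_of_mx.
Proof.
move=> g; apply/lfunP => v; apply: (can_inj vecK).
by rewrite end_of_mxE vec_end.
Qed.

Lemma end_of_mxM M N : end_of_mx (M *m N) = (end_of_mx M \o end_of_mx N)%VF.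
Proof.
apply/lfunP => v; apply: (can_inj vecK).
by rewrite comp_lfunE !end_of_mxE mulmxA.
Qed.

Lemma in_GL_det (g : 'End(V)) : in_GL g <-> \det (mx_of_end g) != 0.
Proof.
split=> [GLg | nz_det].
  suff /mulmx1_unit[+ _] : mx_of_end g *m mx_of_end g^-1%VF = 1%:M.
    by rewrite unitmxE unitfE.
  apply: (can_inj end_of_mxK); rewrite end_of_mxM !mx_of_endK lker0_compfV //.
  apply/lfunP=> v; apply: (can_inj vecK).
  by rewrite end_of_mxE mul1mx id_lfunE.
have Ug : mx_of_end g \in unitmx by rewrite unitmxE unitfE.
apply/lker0P => v w /(congr1 vec); rewrite !vec_end.
move/(congr1 (mulmx (invmx (mx_of_end g)))).
by rewrite !mulKmx // => /(can_inj vecK).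
Qed.

Lemma isomorphic_to_mx (P : 'End(V) -> Prop) S gT :
  (forall g, P g <-> S (mx_of_end g)) ->
  mx_isomorphic_to S gT -> isomorphic_to P gT.
Proof.
move=> PS [f [f_inj fS fM]]; exists (end_of_mx \o f); split.
- by move=> x y /= /(can_inj end_of_mxK)/f_inj.
- move=> g; rewrite PS fS; split=> -[x fx]; exists x => /=.
    by rewrite fx mx_of_endK.
  by rewrite -fx end_of_mxK.
by move=> x y /=; rewrite fM end_of_mxM.
Qed.

(** * Automorphisms in terms of the cubic and the trace form *)

Section Multiplication.
Variable m : {bilinear V -> V -> V}.
Hypothesis m_sym : forall v w : V, m v w = m w v.
Hypotheses (nz2 : 2 != 0 :> F) (nz3 : 3 != 0 :> F).

Local Notation a := (sc_a m e).
Local Notation b := (sc_b m e).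
Local Notation c := (sc_c m e).
Local Notation d := (sc_d m e).
Local Notation s := (sc_e m e).
Local Notation f := (sc_f m e).
Local Notation A := (cub_A m e).
Local Notation B := (cub_B m e).
Local Notation C := (cub_C m e).
Local Notation D := (cub_D m e).

(** The trace of the multiplication by the [i]-th basis vector. *)
Definition trace_form : 'rV[F]_2 := \row_i if i == 0 then a + f else s + d.

(** The multiplication [m] in coordinates. *)
Definition mulv (u v : 'cV[F]_2) : 'cV[F]_2 := \col_i
  if i == 0
  then a * u 0 0 * v 0 0 + s * (u 0 0 * v 1 0 + u 1 0 * v 0 0)
       + c * u 1 0 * v 1 0
  else b * u 0 0 * v 0 0 + f * (u 0 0 * v 1 0 + u 1 0 * v 0 0)
       + d * u 1 0 * v 1 0.

Lemma vec_m v w : vec (m v w) = mulv (vec v) (vec w).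
Proof.
rewrite -{1}[v]vecK -{1}[w]vecK /unvec.
rewrite !(linearDl, linearDr) /= !(linearZl_LR, linearZr_LR) /=.
rewrite [m e`_1 e`_0]m_sym; have o1 : ord_max = 1 :> 'I_2 by apply: val_inj.
apply: cv2P; rewrite !(vecD, vecZ) !mxE /=;
  by rewrite /sc_a /sc_b /sc_c /sc_d /sc_e /sc_f ?o1; ring.
Qed.

Local Notation cubic := (cubic A B C D).

Lemma cubic_mulv u : cubic u = wedge (mulv u u) u.
Proof. by rewrite /cubic /wedge !mxE /= /cub_A /cub_B /cub_C /cub_D; ring. Qed.

Lemma trace_formE (u : 'cV[F]_2) :
  (trace_form *m u) 0 0 = (a + f) * u 0 0 + (s + d) * u 1 0.
Proof. by rewrite mulmx2E !mxE. Qed.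

Lemma trace_mulv (u v w : 'cV[F]_2) : (trace_form *m u) 0 0 * wedge v w =
  wedge (mulv u v) w + wedge v (mulv u w).
Proof. by rewrite trace_formE /wedge !mxE /=; ring. Qed.

(** As [w] varies this determines the squares [mulv u u], hence the whole
    multiplication, from the cubic and the trace form. *)
Lemma wedge_square (u w : 'cV[F]_2) : 3 * wedge (mulv u u) w =
  dcubic A B C D u w + 2 * (trace_form *m u) 0 0 * wedge u w.
Proof.
rewrite trace_formE /dcubic /wedge !mxE /= /cub_A /cub_B /cub_C /cub_D; ring.
Qed.

Lemma mulv_polar u v :
  2 *: mulv u v = mulv (u + v) (u + v) - mulv u u - mulv v v.
Proof. by apply: cv2P; rewrite !mxE /=; ring. Qed.

Lemma mulv_autP (g : 'M[F]_2) : \det g != 0 ->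
  (forall u v, g *m mulv u v = mulv (g *m u) (g *m v)) <->
  aut_mx A B C D trace_form g.
Proof.
move=> nz_g; split=> [g_mulv | [[_ qg] lg]].
  split; first split=> // u.
    by rewrite !cubic_mulv -g_mulv wedge_mulmx.
  suff lgu (u : 'cV[F]_2) :
      (trace_form *m (g *m u)) 0 0 = (trace_form *m u) 0 0.
    apply/rowP=> i; have := lgu (col i 1%:M).
    by rewrite colE mul1mx mulmxA -!colE 2![col _ _ _ _]mxE.
  pose x : 'cV[F]_2 := \col_i (i == 0)%:R.
  pose y : 'cV[F]_2 := \col_i (i == 1)%:R.
  have xy : wedge x y = 1 by rewrite /wedge !mxE /= mulr1 mulr0 subr0.
  apply: (mulfI nz_g); have := trace_mulv (g *m u) (g *m x) (g *m y).
  rewrite -!g_mulv !wedge_mulmx -mulrDr -trace_mulv xy !mulr1 => <-.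
  by rewrite mulrC.
have lgu u : trace_form *m (g *m u) = trace_form *m u by rewrite mulmxA lg.
have Ug : g \in unitmx by rewrite unitmxE unitfE.
have sq u : g *m mulv u u = mulv (g *m u) (g *m u).
  apply: wedge_eqP => w; rewrite -[w](mulKVmx Ug) wedge_mulmx.
  set w' := invmx g *m w; apply: (mulfI nz3); rewrite mulrCA !wedge_square lgu.
  rewrite wedge_mulmx mulrDr; congr (_ + _); last by ring.
  apply: (mulfI nz2); rewrite mulrCA !dcubic_polar -mulmxDr -mulmxBr !qg.
  by ring.
move=> u v; apply: (scalerI nz2); rewrite scalemxAr !mulv_polar.
by rewrite !mulmxBr !sq !mulmxDr.
Qed.

Lemma is_autE (g : 'End(V)) :
  is_aut m g <-> aut_mx A B C D trace_form (mx_of_end g).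
Proof.
split=> [[GLg mg] | aut_g].
  have nz_g := (in_GL_det g).1 GLg; apply/mulv_autP => // u v.
  rewrite -[u]unvecK -[v]unvecK -vec_m -!vec_end -vec_m; congr vec.
  by rewrite -[RHS]mg /gl_act !lker0_lfunK.
have nz_g : \det (mx_of_end g) != 0 by case: aut_g => [[]].
have GLg := (in_GL_det g).2 nz_g; split=> // v w; apply: (can_inj vecK).
rewrite /gl_act vec_end !vec_m (mulv_autP nz_g).2 //.
by rewrite -!vec_end !lker0_lfunVK.
Qed.

End Multiplication.
End Coordinates.

(** The vector whose coordinates are [tau m e]. *)
Definition trace_vec (F : fieldType) (V : vectType F) (e : 2.-tuple V)
    (m : {bilinear V -> V -> V}) : 'cV[F]_2 :=
  \col_i if i == 0 then trace_form e m 0 1 else - trace_form e m 0 0.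

Section AutomorphismGroups.
Variables (F : fieldType) (V : vectType F) (e : 2.-tuple V).
Hypothesis e_basis : basis_of {:V}%VS e.
Variable m : {bilinear V -> V -> V}.
Hypothesis m_sym : forall v w : V, m v w = m w v.
Hypotheses (nz2 : 2 != 0 :> F) (nz3 : 3 != 0 :> F).
Hypothesis nz_disc : disc m e != 0.

Local Notation A := (cub_A m e).
Local Notation B := (cub_B m e).
Local Notation C := (cub_C m e).
Local Notation D := (cub_D m e).
Local Notation lam := (trace_form e m).
Local Notation tauv := (trace_vec e m).

Let tau0 : tau m e ord0 = tauv 0 0.
Proof. by rewrite !mxE /= addrC. Qed.

Let tau1 : tau m e ord_max = tauv 1 0.
Proof. by rewrite !mxE. Qed.

Let tauv_eq0 : tauv = 0 <-> lam = 0.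
Proof.
have tauvE : (tauv 0 0 = lam 0 1) * (tauv 1 0 = - lam 0 0) by rewrite !mxE.
split=> [t0 | l0]; last by apply: cv2P; rewrite tauvE l0 !mxE ?oppr0.
apply/rowP=> i; rewrite [RHS]mxE; elim/ord2P: i.
  by apply: oppr_inj; rewrite -tauvE t0 mxE oppr0.
by rewrite -tauvE t0 mxE.
Qed.

Let nz4 : 4 != 0 :> F. Proof. by rewrite (natrM _ 2 2) mulf_neq0. Qed.

Let iso gT := isomorphic_to_mx (gT := gT) e_basis
  (is_autE e_basis m_sym nz2 nz3).

Lemma Inv_eq0 : (Inv m e == 0) = (covG A B C D tauv == 0).
Proof.
have nz54 : 54%:R != 0 :> F.
  by rewrite (natrM _ 2 27) (natrX _ 3 3) mulf_neq0 ?expf_neq0.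
rewrite /Inv (cub_G_eval _ _ tau0 tau1) mulf_eq0 invr_eq0 (negPf nz54).
by rewrite mulf_eq0 (negPf nz4).
Qed.

(** The invariants [p2] and [p3] are values at [tau] of the Hessian and the
    cubic, which have no common zero. *)
Lemma p23_eq0 : p2 m e = 0 /\ p3 m e = 0 <-> lam = 0.
Proof.
rewrite /p2 /p3 /p2_tilde /p3_tilde (cub_mu_eval _ _ tau0 tau1).
rewrite (fund_cubic_eval _ _ tau0 tau1).
split=> [[/eqP + /eqP] | lam0]; last first.
  have -> : tauv = 0 by apply/tauv_eq0.
  by rewrite /hessian /cubic !mxE; split; ring.
rewrite !mulf_eq0 !invr_eq0 (negPf nz_disc) (negPf nz4) /= !orbF.
have nz8 : 8%:R != 0 :> F by rewrite (natrX _ 2 3) expf_neq0.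
rewrite oppr_eq0 (negPf nz8) /= => /eqP h0 /eqP q0.
have tau_eq0 : tauv = 0.
  apply/eqP; apply: contraT => nz_tau.
  by have := root_hessian_neq0 nz_disc nz_tau q0; rewrite h0 eqxx.
exact/tauv_eq0.
Qed.

Lemma aut_generic : Inv m e != 0 -> isomorphic_to (is_aut m) 'I_1.
Proof.
rewrite Inv_eq0 => nz_G; apply: iso; apply: aut_mx_generic => //.
apply: contra_neq nz_G => lam0; have -> : tauv = 0 by apply/tauv_eq0.
by rewrite /covG /dcubic mulmx0 !mxE; ring.
Qed.

Lemma aut_special : Inv m e = 0 -> (p2 m e, p3 m e) <> (0, 0) ->
  isomorphic_to (is_aut m) 'Z_2.
Proof.
move=> /eqP; rewrite Inv_eq0 => /eqP G0 nz_p; apply: iso.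
apply: aut_mx_special => //; apply/eqP => /p23_eq0[e2 e3].
by apply: nz_p; rewrite e2 e3.
Qed.

Definition has_root := exists2 v, v != 0 & cubic A B C D v = 0.
Definition has_sqrt_disc := exists dl, dl ^+ 2 = disc m e.

Lemma aut_traceless : p2 m e = 0 /\ p3 m e = 0 ->
  [/\ has_root -> has_sqrt_disc -> isomorphic_to (is_aut m) 'S_3,
      has_root -> ~ has_sqrt_disc -> isomorphic_to (is_aut m) 'Z_2,
      ~ has_root -> has_sqrt_disc -> isomorphic_to (is_aut m) 'Z_3
    & ~ has_root -> ~ has_sqrt_disc -> isomorphic_to (is_aut m) 'I_1].
Proof.
move=> /p23_eq0 lam0.
have no_root : ~ has_root -> forall v, cubic A B C D v = 0 -> v = 0.
  by move=> nr v q0; apply/eqP; apply: contraT => nz_v; case: nr; exists v.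
have no_sqrt : ~ has_sqrt_disc -> forall dl, dl ^+ 2 != disc m e.
  by move=> ns dl; apply/eqP => e2; apply: ns; exists dl.
split.
- move=> [v nz_v q0] [dl dl2]; apply: iso; rewrite lam0.
  exact: (aut_mx_root_sqrt nz2 nz3 nz_disc dl2 nz_v q0).
- move=> [v nz_v q0] /no_sqrt ns; apply: iso; rewrite lam0.
  exact: (aut_mx_root_nosqrt nz2 nz3 nz_disc nz_v q0 ns).
- move=> /no_root nr [dl dl2]; apply: iso; rewrite lam0.
  exact: (aut_mx_noroot_sqrt nz2 nz3 nz_disc dl2 nr).
move=> /no_root nr /no_sqrt ns; apply: iso; rewrite lam0.
exact: aut_mx_noroot_nosqrt.
Qed.

End AutomorphismGroups.

(** * Splitting fields of a binary cubic *)

Section SplittingCubic.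
Variables (F : fieldType) (K : fieldExtType F) (A B C D : F).
Hypotheses (nz2 : 2 != 0 :> F) (nz_disc : cubic_disc A B C D != 0).

Local Notation q := (cubic_mpoly A B C D).
Local Notation disc := (cubic_disc A B C D).
Local Notation cubicK := (@cubic K A%:A B%:A C%:A D%:A).
Local Notation covK := (@covG K A%:A B%:A C%:A D%:A).

Local Notation inA := (GRing.in_alg K).

Lemma cubic_disc_alg : cubic_disc A%:A B%:A C%:A D%:A = disc%:A :> K.
Proof. exact: (cubic_disc_rmorph inA). Qed.

Let nz2K : 2 != 0 :> K.
Proof. by rewrite -(rmorph_nat inA) fmorph_eq0. Qed.
Let nz_discK : cubic_disc A%:A B%:A C%:A D%:A != 0 :> K.
Proof. by rewrite cubic_disc_alg -/(inA _) fmorph_eq0. Qed.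

Let map_q : map_mpoly inA q = cubic_mpoly A%:A B%:A C%:A D%:A.
Proof.
rewrite /cubic_mpoly !(exprS, expr0, mulr1).
by rewrite !rmorphD /= !map_mpolyZ !rmorphM /= !map_mpolyX.
Qed.

(** The product of the pairwise wedges of the linear factors is a square root
    of the discriminant. *)
Lemma splits_over_root (E : {subfield K}) : Defs.splits_over q E ->
  (exists v : 'cV[K]_2, [/\ v != 0, v 0 0 \in E, v 1 0 \in E & cubicK v = 0])
  /\ exists2 dl, dl \in E & dl ^+ 2 = disc%:A.
Proof.
case=> l1 [l2 [l3 [lE qE]]].
have lin l : l \in [:: l1; l2; l3] ->
    exists u : 'cV[K]_2, [/\ u 0 0 \in E, u 1 0 \in E &
                             l = lin_mpoly (u 1 0) (- u 0 0)].
  case/lE/andP=> /mpolyOverP lE1 /homog1_lin_mpoly ->.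
  pose u : 'cV[K]_2 := \col_i if i == 0 then - l@_U_(ord_max) else l@_U_(ord0).
  by exists u; rewrite !mxE /= opprK rpredN !lE1.
have [|u [u0 u1 l1E]] := lin l1; first by rewrite !inE eqxx.
have [|v [v0 v1 l2E]] := lin l2; first by rewrite !inE eqxx orbT.
have [|w [w0 w1 l3E]] := lin l3; first by rewrite !inE eqxx !orbT.
move: qE; rewrite map_q l1E l2E l3E lin_mpolyM3.
set a := u 1 0 * _ * _; set b := _ + _ + _; set c := _ + _ + _.
set d := _ * _ * _ => qE.
have [||eA eB eC eD] := @binary_cubic_eq K A%:A B%:A C%:A D%:A a b c d => //.
  move=> x y; pose z : 'cV[K]_2 := \col_i if i == 0 then x else y.
  have := congr1 (meval (fun i => if i == ord0 then z 0 0 else z 1 0)) qE.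
  by rewrite !cubic_mpoly_eval /cubic !mxE.
have disc_wedge : (wedge u v * wedge v w * wedge w u) ^+ 2 = disc%:A.
  by rewrite -cubic_disc_alg eA eB eC eD /cubic_disc /a /b /c /d /wedge; ring.
split; last first.
  exists (wedge u v * wedge v w * wedge w u) => //.
  by rewrite /wedge !(rpredM, rpredB).
exists u; split=> //.
  apply: contraNneq nz_discK => u0'.
  by rewrite cubic_disc_alg -disc_wedge u0' /wedge !mxE; apply/eqP; ring.
by rewrite /cubic eA eB eC eD /a /b /c /d; ring.
Qed.

Lemma root_splits_over (E : {subfield K}) (v : 'cV[K]_2) (dl : K) :
  v != 0 -> v 0 0 \in E -> v 1 0 \in E -> cubicK v = 0 ->
  dl \in E -> dl ^+ 2 = disc%:A -> Defs.splits_over q E.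
Proof.
move=> nz_v v0 v1 q0 dlE dl2.
(* The factors are those of [cubic_factor], a difference of two squares. *)
have algE (k : F) : k%:A \in E by rewrite rpredZ // rpred1.
pose J := hessJ (A%:A : K) B%:A C%:A D%:A *m v.
have J0 : J 0 0 \in E.
  rewrite /J hessJE mulmx2E !mx22E /hess0 /hess1 /hess2.
  by rewrite !(rpred_nat, algE, v0, v1, rpredD, rpredM, rpredN, rpredX).
have J1 : J 1 0 \in E.
  rewrite /J hessJE mulmx2E !mx22E /hess0 /hess1 /hess2.
  by rewrite !(rpred_nat, algE, v0, v1, rpredD, rpredM, rpredN, rpredX).
have nz_G : covK v != 0 by apply: root_covG_neq0.
have GE : covK v \in E.
  rewrite /covG -/J /dcubic.
  by rewrite !(rpred_nat, algE, v0, v1, J0, J1, rpredD, rpredM, rpredN, rpredX).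
pose k := (2 * covK v)^-1.
pose l (u : 'cV[K]_2) := lin_mpoly (- u 1 0) (u 0 0).
pose u1 := k *: v; pose u2 := J + (- dl) *: v; pose u3 := J + dl *: v.
exists (l u1), (l u2), (l u3); split.
  have lE (u : 'cV[K]_2) : u 0 0 \in E -> u 1 0 \in E ->
      (l u \is a mpolyOver 2 E) && (l u \is 1.-homog).
    move=> u0E u1E; rewrite lin_mpoly_homog andbT.
    by rewrite rpredD ?mpolyOverZ ?mpolyOverX ?rpredN.
  have kE : k \in E by rewrite rpredV rpredM ?rpred_nat.
  have pencil_E t i : t \in E -> J i 0 \in E -> v i 0 \in E ->
      (J + t *: v) i 0 \in E.
    move=> tE; move: (J) => w JE vE; rewrite 2!mxE.
    by apply: rpredD => //; apply: rpredM.
  move=> p; rewrite !inE => /or3P[] /eqP ->; apply: lE.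
  1,2: by rewrite mxE rpredM.
  1-4: by apply: pencil_E; rewrite ?rpredN.
rewrite map_q lin_mpolyM3.
set a := _ * _ * _; set b := _ + _ + _; set c := _ + _ + _.
set d := _ * _ * _.
have [|-> -> -> ->] // := @binary_cubic_eq K A%:A B%:A C%:A D%:A a b c d nz2K.
move=> x y; pose w : 'cV[K]_2 := \col_i if i == 0 then x else y.
have := cubic_factor A%:A B%:A C%:A D%:A v w.
rewrite q0 mul0r subr0 cubic_disc_alg -dl2 -/J mulrA => e.
have {}e : cubicK w =
    k * (wedge v w * (wedge J w ^+ 2 - dl ^+ 2 * wedge v w ^+ 2)).
  by rewrite -e mulKf // mulf_neq0.
move: e; rewrite /cubic /wedge !mxE /= => ->.
by rewrite /a /b /c /d /u1 /u2 /u3 !mxE; ring.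
Qed.

Section Degree.
Hypothesis split_q : is_splitting_field K q.

Let root_F := exists2 v : 'cV[F]_2, v != 0 & cubic A B C D v = 0.
Let sqrt_F := exists dl, dl ^+ 2 = disc.

Let minimal (E : {subfield K}) : Defs.splits_over q E -> \dim E = \dim {:K}.
Proof. by move=> /(proj2 split_q) ->. Qed.

Let sqrt_K : exists dl : K, dl ^+ 2 = disc%:A.
Proof.
by have [_ [dl _ dl2]] := splits_over_root (proj1 split_q); exists dl.
Qed.

Let mem1P (x : K) : reflect (exists k, x = k%:A) (x \in 1%VS).
Proof. exact: vlineP. Qed.

Lemma adjoin_sqrt_le2 (E : {subfield K}) dl : dl ^+ 2 = disc%:A ->
  (adjoin_degree E dl <= 2)%N.
Proof.
move=> dl2; have p_over : 'X^2 - (disc%:A)%:P \is a polyOver E.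
  by rewrite rpredB ?rpredX ?polyOverX ?polyOverC // rpredZ ?rpred1.
have : minPoly E dl %| 'X^2 - (disc%:A)%:P.
  by apply: minPoly_dvdp => //; rewrite rootE !hornerE dl2 subrr.
move/dvdp_leq; rewrite size_minPoly size_XnsubC // ltnS; apply.
by rewrite -size_poly_eq0 size_XnsubC.
Qed.

Lemma sqrt_F_mem1 dl : dl ^+ 2 = disc%:A ->
  sqrt_F <-> dl \in (1%VS : {vspace K}).
Proof.
move=> dl2; split=> [[k k2]|/mem1P[k dlE]].
  have /eqP : dl ^+ 2 = (k%:A) ^+ 2 by rewrite dl2 -k2 -!in_algE rmorphXn.
  by rewrite eqf_sqr => /orP[] /eqP ->; rewrite ?rpredN rpredZ ?rpred1.
exists k; apply: (fmorph_inj inA); rewrite rmorphXn /=.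
by rewrite -dlE dl2.
Qed.

(** The subfield generated by a square root of [disc] has degree at most 2,
    dividing the degree of [K]. *)
Lemma odd_dim_sqrt : odd (\dim {:K}) -> sqrt_F.
Proof.
move=> oddK; have [dl dl2] := sqrt_K; apply/(sqrt_F_mem1 dl2).
rewrite -adjoin_deg_eq1; have := adjoin_sqrt_le2 1%AS dl2.
have : (adjoin_degree 1%AS dl %| \dim {:K})%N.
  have := dim_Fadjoin 1%AS dl; rewrite dimv1 muln1 => <-.
  exact/field_dimS/subvf.
case: (adjoin_degree _ _) => [|[|[|]]] //; rewrite ?dvd0n ?dvdn2 ?oddK //.
by case: (\dim _) oddK.
Qed.

(** One root in the base field leaves a square root of [disc] to adjoin. *)
Lemma root_dim : root_F -> (\dim {:K} <= 2)%N /\ (sqrt_F -> \dim {:K} = 1%N).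
Proof.
move=> [v nz_v q0]; have [dl dl2] := sqrt_K.
pose w : 'cV[K]_2 := map_mx inA v.
have nz_w : w != 0 by rewrite map_mx_eq0.
have w0 : cubicK w = 0.
  by rewrite -[RHS](rmorph0 inA) -q0; apply: (cubic_rmorph inA).
have wE (E : {subfield K}) i : w i 0 \in E by rewrite mxE rpredZ ?rpred1.
have splitE (E : {subfield K}) : dl \in E -> \dim E = \dim {:K}.
  by move=> dlE; apply/minimal/(root_splits_over nz_w _ _ w0 dlE dl2).
split; last by move/(sqrt_F_mem1 dl2)/splitE <-; rewrite dimv1.
rewrite -(splitE <<1; dl>>%AS) ?memv_adjoin // dim_Fadjoin dimv1 muln1.
exact: adjoin_sqrt_le2.
Qed.

(** The cubic is irreducible, so a root generates a subfield of degree 3, over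
    which a square root of [disc] remains to be adjoined. *)
Lemma noroot_dim : ~ root_F ->
  (3 %| \dim {:K})%N /\ (sqrt_F <-> \dim {:K} = 3%N).
Proof.
move=> no_root; have [[v [nz_v _ _ q0]] _] := splits_over_root (proj1 split_q).
have nz_A : A != 0.
  apply/eqP => A0; apply: no_root; exists (\col_i (i == 0)%:R).
    by apply/eqP => /colP/(_ 0)/eqP; rewrite !mxE oner_eq0.
  by rewrite /cubic !mxE A0 /=; ring.
(* A root at infinity would be rational. *)
have nz_v1 : v 1 0 != 0.
  apply: contra_neq nz_v => v1; apply: cv2P; rewrite mxE //.
  have /eqP := q0; rewrite /cubic v1 !expr0n /= !mulr0 !addr0 mulf_eq0.
  by rewrite expf_eq0 /= -in_algE fmorph_eq0 (negPf nz_A) => /eqP.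
pose w := (v 1 0)^-1 *: v; pose th := w 0 0.
have w1 : w 1 0 = 1 by rewrite mxE mulVf.
have w_root : cubicK w = 0 by rewrite cubicZ q0 mulr0.
pose p : {poly F} := Poly [:: D; C; B; A].
have pE (k : F) : p.[k] = cubic A B C D (\col_i if i == 0 then k else 1).
  by rewrite horner_Poly /= /cubic !mxE /=; ring.
have sz_p : size p = 4%N by rewrite (@PolyK _ 0).
have p_irr : irreducible_poly p.
  apply: cubic_irreducible; first by rewrite sz_p.
  move=> k; apply/negP; rewrite rootE pE => /eqP pk0; apply: no_root.
  exists (\col_i if i == 0 then k else 1) => //.
  by apply/eqP => /colP/(_ 1)/eqP; rewrite !mxE oner_eq0.
have p_th : root (map_poly inA p) th.
  rewrite rootE map_Poly_id0 ?rmorph0 // horner_Poly /=; apply/eqP.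
  by rewrite -[RHS]w_root /cubic w1 -/th; ring.
have deg_th : adjoin_degree 1%AS th = 3%N.
  have /minPoly_dvdp : map_poly inA p \is a polyOver 1%VS.
    by apply/polyOver1P; exists p.
  move=> /(_ _ p_th); have /polyOver1P[p' p'E] := minPolyOver 1%AS th.
  have sz_p' : size p' = (adjoin_degree 1%AS th).+1.
    by rewrite -(size_map_poly inA) -p'E size_minPoly.
  rewrite p'E dvdp_map => /p_irr.2; rewrite sz_p' => /(_ isT)/eqp_size.
  by rewrite sz_p' sz_p => /eqP; rewrite eqSS => /eqP.
have dim_th : \dim <<1; th>>%AS = 3%N by rewrite dim_Fadjoin deg_th dimv1.
have [dl dl2] := sqrt_K.
have splitE (E : {subfield K}) : th \in E -> dl \in E -> \dim E = \dim {:K}.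
  move=> thE dlE; apply/minimal/(root_splits_over _ thE _ w_root dlE dl2).
    by rewrite scaler_eq0 invr_eq0 (negPf nz_v1).
  by rewrite w1 rpred1.
split; first by rewrite -dim_th; apply/field_dimS/subvf.
split=> [sqF | dim3]; last by apply: odd_dim_sqrt; rewrite dim3.
rewrite -dim_th -(splitE <<1; th>>%AS) ?memv_adjoin //.
by apply: (subvP (subv_adjoin _ _)); apply/(sqrt_F_mem1 dl2).
Qed.

End Degree.

End SplittingCubic.

(** * Extension of scalars *)

Section ScalarExtension.
Variables (F : fieldType) (K : fieldExtType F).
Variables (V : vectType F) (VK : vectType K).
Variable iota : {linear V -> VK | GRing.in_alg K \; *:%R}.
Hypothesis iota_ext : scalar_extension iota.
Variable e : 2.-tuple V.
Hypothesis e_basis : basis_of {:V}%VS e.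
Local Notation inA := (GRing.in_alg K).

Definition ext_tuple : 2.-tuple VK := map_tuple iota e.
Local Notation eK := ext_tuple.

Lemma ext_tupleE (i : 'I_2) : eK`_i = iota e`_i.
Proof. by rewrite (nth_map 0) ?size_tuple. Qed.

Lemma iota_coord v : iota v = \sum_i (coord e i v)%:A *: eK`_i.
Proof.
rewrite {1}(coord_basis e_basis (memvf v)) linear_sum.
by apply: eq_bigr => i _; rewrite linearZ ext_tupleE.
Qed.

Definition coordK (j : 'I_2) (v : V) : K^o := (coord e j v)%:A.

Lemma coordK_linear j : linear_for (inA \; *:%R) (coordK j).
Proof.
move=> a u v; rewrite /coordK linearP /= scalerDl -scalerA.
by rewrite [in RHS]/GRing.scale /= mulr_algl.
Qed.

HB.instance Definition _ j := GRing.isLinear.Build F V K^o (inA \; *:%R)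
  (coordK j) (coordK_linear j).

(** Existence in the universal property, applied to coordinate functions, gives
    freeness; uniqueness gives generation, since the projection onto the span
    fixes the image of [iota]. *)
Lemma ext_tuple_basis : basis_of {:VK}%VS eK.
Proof.
rewrite /basis_of eqEsubv subvf /=; apply/andP; split; last first.
  have coordE (i j : 'I_2) : coord e j e`_i = (i == j)%:R.
    exact: coord_free (basis_free e_basis).
  apply/(@freeP _ _ 2 eK) => k sum0 j; have [g gE _] := iota_ext (coordK j).
  have := congr1 g sum0; rewrite linear0 linear_sum (bigD1 j) //=.
  rewrite big1 => [|i ne_ij].
    rewrite addr0 linearZ /= ext_tupleE gE /= /coordK coordE eqxx scale1r.
    by rewrite /GRing.scale /= mulr1.
  rewrite linearZ /= ext_tupleE gE /= /coordK coordE.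
  by rewrite (negPf ne_ij) scale0r scaler0.
have [g _ g_unique] := iota_ext iota.
apply/subvP => v _.
have projE (u : V) : projv <<eK>>%VS (iota u) = iota u.
  apply: projv_id; rewrite iota_coord; apply: rpred_sum => i _.
  by apply/rpredZ/memv_span/mem_nth; rewrite size_tuple.
have := g_unique (projv <<eK>>%VS) projE v.
have := g_unique idfun (fun=> erefl) v.
by move=> /= <- => {1}<-; apply: memv_proj.
Qed.

Lemma coord_ext_tuple i v : coord eK i (iota v) = (coord e i v)%:A.
Proof.
by rewrite iota_coord coord_sum_free //; apply: basis_free ext_tuple_basis.
Qed.

Variables (m : {bilinear V -> V -> V}) (mK : {bilinear VK -> VK -> VK}).
Hypothesis m_sym : forall v w : V, m v w = m w v.
Hypothesis mK_ext : extends_bilinear iota m mK.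

Lemma ext_bilinear_sym v w : mK v w = mK w v.
Proof.
rewrite (coord_basis ext_tuple_basis (memvf v)).
rewrite (coord_basis ext_tuple_basis (memvf w)).
rewrite !sum2E !(linearDl, linearDr) /= !(linearZl_LR, linearZr_LR) /=.
have := ext_tupleE 0; have := ext_tupleE 1; rewrite /= => -> ->.
rewrite !mK_ext [m e`_1 e`_0]m_sym.
by rewrite !scalerA addrACA ![coord eK 0 w * _]mulrC ![coord eK 1 w * _]mulrC.
Qed.

Lemma sc_ext : [/\ sc_a mK eK = (sc_a m e)%:A, sc_b mK eK = (sc_b m e)%:A,
  sc_c mK eK = (sc_c m e)%:A, sc_d mK eK = (sc_d m e)%:A &
  sc_e mK eK = (sc_e m e)%:A /\ sc_f mK eK = (sc_f m e)%:A].
Proof.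
have e0 := ext_tupleE ord0; have e1 := ext_tupleE ord_max.
rewrite /= in e0 e1.
by rewrite /sc_a /sc_b /sc_c /sc_d /sc_e /sc_f e0 e1 !mK_ext !coord_ext_tuple.
Qed.

Lemma cub_ext : [/\ cub_A mK eK = (cub_A m e)%:A, cub_B mK eK = (cub_B m e)%:A,
  cub_C mK eK = (cub_C m e)%:A & cub_D mK eK = (cub_D m e)%:A].
Proof.
have [a b c d [e_ f]] := sc_ext.
rewrite /cub_A /cub_B /cub_C /cub_D a b c d e_ f -!in_algE.
by split; rewrite ?(rmorph_nat, rmorphN, rmorphB, rmorphM).
Qed.

Lemma trace_form_ext : trace_form eK mK = map_mx inA (trace_form e m).
Proof.
have [a b c d [e_ f]] := sc_ext.
by apply/rowP=> i; rewrite !mxE a d e_ f -!in_algE -!rmorphD; case: ifP.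
Qed.

Lemma trace_vec_ext : trace_vec eK mK = map_mx inA (trace_vec e m).
Proof.
apply/colP=> i; rewrite [LHS]mxE trace_form_ext.
rewrite [(map_mx _ _) 0 1]mxE [(map_mx _ _) 0 0]mxE !mxE.
by case: ifP => _; rewrite ?rmorphN.
Qed.

Lemma disc_ext : disc mK eK = (disc m e)%:A.
Proof.
have [a b c d] := cub_ext; rewrite -[RHS]cubic_disc_alg -a -b -c -d //.
Qed.

Lemma covG_ext v :
  covG (cub_A mK eK) (cub_B mK eK) (cub_C mK eK) (cub_D mK eK) (map_mx inA v)
  = (covG (cub_A m e) (cub_B m e) (cub_C m e) (cub_D m e) v)%:A.
Proof.
by have [-> -> -> ->] := cub_ext; apply: (covG_rmorph inA).
Qed.

End ScalarExtension.

Theorem corollary4p12 (F : fieldType)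
    (char2 : 2%N \notin [pchar F]) (char3 : 3%N \notin [pchar F])
    (V : vectType F) (dimV : \dim {:V} = 2%N)
    (m : {bilinear V -> V -> V}) (m_sym : forall v w : V, m v w = m w v)
    (e : 2.-tuple V) (e_basis : basis_of {:V}%VS e)
    (m_disc : disc m e != 0) :
  (forall (K : fieldExtType F) (VK : vectType K)
      (iota : {linear V -> VK | GRing.in_alg K \; *:%R})
      (mK : {bilinear VK -> VK -> VK}),
    is_splitting_field K (fund_cubic m e) ->
    scalar_extension iota ->
    extends_bilinear iota m mK ->
    [/\ Inv m e != 0 -> isomorphic_to (is_aut mK) 'I_1,
        Inv m e = 0 -> (p2 m e, p3 m e) <> (0, 0) ->
          isomorphic_to (is_aut mK) 'Z_2
      & p2 m e = 0 /\ p3 m e = 0 -> isomorphic_to (is_aut mK) 'S_3])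
  /\
  [/\ Inv m e != 0 -> isomorphic_to (is_aut m) 'I_1,
      Inv m e = 0 -> (p2 m e, p3 m e) <> (0, 0) ->
        isomorphic_to (is_aut m) 'Z_2
    & forall K : fieldExtType F, is_splitting_field K (fund_cubic m e) ->
      p2 m e = 0 /\ p3 m e = 0 ->
      [/\ \dim {:K} = 1%N -> isomorphic_to (is_aut m) 'S_3,
          \dim {:K} = 2%N -> isomorphic_to (is_aut m) 'Z_2,
          \dim {:K} = 3%N -> isomorphic_to (is_aut m) 'Z_3
        & \dim {:K} = 6%N -> isomorphic_to (is_aut m) 'I_1]].
Proof.
have nz2 : 2 != 0 :> F by move: char2; rewrite inE.
have nz3 : 3 != 0 :> F by move: char3; rewrite inE.
split; last first.
  split; [exact: (aut_generic e_basis m_sym nz2 nz3 m_disc) |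
    exact: (aut_special e_basis m_sym nz2 nz3 m_disc) | move=> K splitK p0].
  have [S3 Z2 Z3 triv] := aut_traceless e_basis m_sym nz2 nz3 m_disc p0.
  have rootP := root_dim nz2 m_disc splitK.
  have norootP := noroot_dim nz2 m_disc splitK.
  have oddP := odd_dim_sqrt nz2 m_disc splitK.
  (* Over an arbitrary field the existence of a root is decided classically. *)
  have root_dec : has_root e m \/ ~ has_root e m.
    exact: Classical_Prop.classic.
  split=> dimK.
  - apply: S3; last by apply: oddP; rewrite dimK.
    by case: root_dec => // /norootP[]; rewrite dimK.
  - apply: Z2; first by case: root_dec => // /norootP[]; rewrite dimK.
    by move=> sq; case: root_dec => [/rootP[_ /(_ sq)]|/norootP[]]; rewrite dimK.
  - apply: Z3; last by apply: oddP; rewrite dimK.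
    by move=> /rootP[]; rewrite dimK.
  apply: triv; first by move=> /rootP[]; rewrite dimK.
  by move=> sq; case: root_dec => [/rootP[]|/norootP[_ [/(_ sq)]]]; rewrite dimK.
move=> K VK iota mK splitK iota_ext mK_ext.
pose eK := ext_tuple iota e.
have eK_basis : basis_of {:VK}%VS eK := ext_tuple_basis iota_ext e_basis.
have mK_sym := ext_bilinear_sym iota_ext e_basis m_sym mK_ext.
have nz2K : 2 != 0 :> K by rewrite -(rmorph_nat (GRing.in_alg K)) fmorph_eq0.
have nz3K : 3 != 0 :> K by rewrite -(rmorph_nat (GRing.in_alg K)) fmorph_eq0.
have nz_discK : disc mK eK != 0.
  by rewrite (disc_ext iota_ext e_basis mK_ext) -in_algE fmorph_eq0.
have InvK : (Inv mK eK == 0) = (Inv m e == 0).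
  rewrite !Inv_eq0 // (trace_vec_ext iota_ext e_basis mK_ext).
  by rewrite (covG_ext iota_ext e_basis mK_ext) -in_algE fmorph_eq0.
have pK : p2 mK eK = 0 /\ p3 mK eK = 0 <-> p2 m e = 0 /\ p3 m e = 0.
  rewrite !p23_eq0 // (trace_form_ext iota_ext e_basis mK_ext).
  split=> [/eqP|->]; last by rewrite map_mx0.
  by rewrite map_mx_eq0 => /eqP.
split.
- by rewrite -InvK; apply: (aut_generic eK_basis mK_sym nz2K nz3K nz_discK).
- move=> /eqP; rewrite -InvK => /eqP Inv0 nz_p.
  apply: (aut_special eK_basis mK_sym nz2K nz3K nz_discK Inv0) => -[e2 e3].
  have [e2' e3'] := pK.1 (conj e2 e3).
  by apply: nz_p; rewrite e2' e3'.
move=> /pK p0.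
have [S3 _ _ _] := aut_traceless eK_basis mK_sym nz2K nz3K nz_discK p0.
have [[v [nz_v _ _ q0]] [dl _ dl2]] :=
  splits_over_root nz2 m_disc (proj1 splitK).
have [a b c d] := cub_ext iota_ext e_basis mK_ext.
apply: S3.
  by exists v => //; rewrite a b c d.
by exists dl; rewrite (disc_ext iota_ext e_basis mK_ext).
Qed.
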